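(* Let $\mathcal{L}$ be a pseudodifferential operator acting on vector fields on $\mathbb{R}^n$ with matrix symbol $\mathcal{M}(\xi)=P^{-1}(\xi)D(\xi)P(\xi)$ for a.e. $\xi\in\mathbb{R}^n$, where $P(\xi)\in O(n)$ and $D(\xi)_{ij}=-c_i|\xi|^{2\alpha}\delta_{ij}$ with constants $c_i>c>0$ ($i=1,\dots,n$) and $0<\alpha\le 1$. Let $v_0\in L^2(\mathbb{R}^n)$ (vector valued) have decay character $r^{*}(v_0)=r^{*}$, and let $v(t)$ be the solution to $v_t=\mathcal{L}v$ with data $v(0)=v_0$. Then: (1) if $-\frac n2<r^{*}<\infty$, there exist constants $C_1,C_2>0$ such that for all $t\ge 0$ $$C_1(1+t)^{-\frac1\alpha\left(\frac n2+r^{*}\right)}\le \|v(t)\|_{L^2}^2\le C_2(1+t)^{-\frac1\alpha\left(\frac n2+r^{*}\right)};$$ (2) if $r^{*}=-\frac n2$, then for every $\epsilon>0$ there exists $C=C(\epsilon)>0$ such that for all $t\ge0$ $$\|v(t)\|_{L^2}^2\ge C(1+t)^{-\epsilon},$$ i.e. the decay of $\|v(t)\|_{L^2}^2$ is slower than any uniform algebraic rate; (3) if $r^{*}=\infty$, then for every $m>0$ there exists $C=C(m)>0$ such that for all $t\ge 0$ $$\|v(t)\|_{L^2}^2\le C(1+t)^{-m},$$ i.e. the decay of $\|v(t)\|_{L^2}$ is faster than any algebraic rate.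
   Context: Decay indicator: for $u_0\in L^2(\mathbb{R}^n)$ (scalar or vector valued, $|\cdot|$ the Euclidean norm) and $r\in(-\frac n2,\infty)$, $$P_r(u_0)=\lim_{\rho\to0}\rho^{-2r-n}\int_{B(\rho)}|\widehat{u}_0(\xi)|^2\,d\xi,$$ where $B(\rho)$ is the ball of radius $\rho$ centered at the origin. Decay character: $r^{*}(u_0)$ is the unique $r\in(-\frac n2,\infty)$ such that $0<P_r(u_0)<\infty$, provided this number exists; if no such $r$ exists, one sets $r^{*}(u_0)=-\frac n2$ when $P_r(u_0)=\infty$ for all $r\in(-\frac n2,\infty)$, and $r^{*}(u_0)=\infty$ when $P_r(u_0)=0$ for all $r\in(-\frac n2,\infty)$. Saying that $v_0$ has decay character $r^{*}$ means that $r^{*}(v_0)$ is defined by one of these alternatives and equals $r^{*}$. The solution of $v_t=\mathcal{L}v$ is given in frequency by $\widehat v(\xi,t)=e^{t\mathcal{M}(\xi)}\widehat{v}_0(\xi)$. *)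

(* Defs.v *)
From HB Require Import structures.
From mathcomp Require Import all_boot all_order all_algebra.
From mathcomp Require Import complex.
From mathcomp Require Import all_classical all_reals all_analysis.
Set Implicit Arguments. Unset Strict Implicit. Unset Printing Implicit Defensive.
Import Order.TTheory GRing.Theory Num.Theory.
Import numFieldNormedType.Exports.
Local Open Scope classical_set_scope.
Local Open Scope ring_scope.

Definition tuple_cons (T : Type) n (p : T * n.-tuple T) : n.+1.-tuple T :=
  [tuple of p.1 :: p.2].

Section tuple_product.
Context d (T : measurableType d) (R : realType) (n : nat).
Context (m1 : {sigma_finite_measure set T -> \bar R}).
Context (m2 : {sigma_finite_measure set (n.-tuple T) -> \bar R}).

Lemma measurable_tuple_cons : measurable_fun setT (@tuple_cons T n).
Proof. exact: measurable_cons. Qed.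

Definition cons_measure : set (n.+1.-tuple T) -> \bar R :=
  pushforward (m1 \x m2)%E (@tuple_cons T n).

Let cons_measure0 : cons_measure set0 = 0%E.
Proof. by rewrite /cons_measure /pushforward preimage_set0 measure0. Qed.

Let cons_measure_ge0 A : (0 <= cons_measure A)%E.
Proof. exact: (measure_ge0 (m1 \x m2)%E). Qed.

Let cons_measure_sigma_additive : semi_sigma_additive cons_measure.
Proof.
apply: (@measure_semi_sigma_additive _ _ _ (pushforward _ _)).
exact: measurable_tuple_cons.
Qed.

HB.instance Definition _ := isMeasure.Build _ _ _ cons_measure
  cons_measure0 cons_measure_ge0 cons_measure_sigma_additive.

Let cons_measure_sigma_finite : sigma_finite setT cons_measure.
Proof.
pose unc (y : n.+1.-tuple T) := (thead y, [tuple of behead y]).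
have munc : measurable_fun setT unc.
  apply/measurable_fun_pairP; split; first exact: (measurable_tnth ord0).
  exact: measurable_behead.
have /sigma_finiteP[F [TF ndF Foo]] := sigma_finiteT m1.
have /sigma_finiteP[G [TG ndG Goo]] := sigma_finiteT m2.
exists (fun k => unc @^-1` (F k `*` G k)).
  apply/seteqP; split=> // y _.
  have : (\bigcup_k F k) (unc y).1 by rewrite -TF.
  have : (\bigcup_k G k) (unc y).2 by rewrite -TG.
  move=> [j _ Gj] [i _ Fi]; exists (maxn i j) => //; split.
    by move: Fi; apply/subsetPset/ndF/leq_maxl.
  by move: Gj; apply/subsetPset/ndG/leq_maxr.
move=> k; have [mF Fk] := Foo k; have [mG Gk] := Goo k; split.
  by rewrite -[X in measurable X]setTI; apply: munc => //; exact: measurableX.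
rewrite /cons_measure /pushforward -comp_preimage.
rewrite (_ : unc \o _ = id); last first.
  by apply/funext => -[x y]; congr pair; apply/val_inj.
by rewrite preimage_id product_measure1E// lte_mul_pinfty// ge0_fin_numE.
Qed.

HB.instance Definition _ := Measure_isSigmaFinite.Build _ _ _ cons_measure
  cons_measure_sigma_finite.
End tuple_product.

(* Lebesgue measure on R^n, by induction on n: the image of the product of the
   one-dimensional measure and the measure on R^n under (x, y) |-> x :: y.
   lebesgue_tuple_box below gives its value on boxes. *)
Fixpoint lebesgue_tuple (R : realType) (n : nat) :
    {sigma_finite_measure set (n.-tuple (measurableTypeR R)) -> \bar R} :=
  match n with
  | 0%N => dirac [tuple]
  | n'.+1 => cons_measure (@lebesgue_measure R) (lebesgue_tuple R n')
  end.

Notation Rn R n := (n.-tuple (measurableTypeR R)).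

Lemma measurable_tuple_box (R : realType) n
    (A : 'I_n -> set (measurableTypeR R)) :
  (forall i, measurable (A i)) ->
  measurable [set x : Rn R n | forall i, A i (tnth x i)].
Proof.
move=> mA.
rewrite [X in measurable X](_ : _ = \bigcap_(i in [set: 'I_n]) (@tnth n _ ^~ i) @^-1` A i).
  apply: fin_bigcap_measurable => // i _; rewrite -[X in measurable X]setTI.
  exact: measurable_tnth.
by apply/seteqP; split => x /= xA i => [_|]; exact: xA.
Qed.

Lemma lebesgue_tuple_box (R : realType) n
    (A : 'I_n -> set (measurableTypeR R)) :
  (forall i, measurable (A i)) ->
  lebesgue_tuple R n [set x | forall i, A i (tnth x i)] =
  (\prod_(i < n) lebesgue_measure (A i))%E.
Proof.
elim: n A => [|n IH] A mA.
  rewrite big_ord0 /= diracE (_ : (_ \in _) = true)//; apply/mem_set; by case.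
rewrite big_ord_recl -(IH (fun i => A (lift ord0 i)))// /= /cons_measure.
have mB := measurable_tuple_box (fun i => mA (lift ord0 i)).
rewrite -product_measure1E//.
rewrite /pushforward; congr (_ _); apply/seteqP; split => -[x y] /= xy.
  split; first by have := xy ord0.
  by move=> i; have := xy (lift ord0 i); rewrite tnthS.
move=> i; case: (unliftP ord0 i) => [j ->|->]; last exact: xy.1.
rewrite /tuple_cons/= tnthS; exact: xy.2.
Qed.

Section space.
Context {R : realType} {n : nat}.
Implicit Types x xi : Rn R n.

Definition dotn x xi : R := \sum_(i < n) (tnth x i : R) * (tnth xi i : R).

Definition enorm x : R := Num.sqrt (dotn x x).

Definition ball0 (rho : R) : set (Rn R n) := [set x | enorm x < rho].

End space.

(* Fields are complex valued: neither v0 nor the symbol is assumed to have the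
   symmetry making v(t) real. Real fields are those with zero imaginary part. *)
Notation vfield R n := (Rn R n -> 'cV[R[i]]_n).

Section fields.
Context {R : realType} {n : nat}.
Local Notation mu := (lebesgue_tuple R n).
Implicit Types u w : vfield R n.

Definition cnorm (z : 'cV[R[i]]_n) : R :=
  Num.sqrt (\sum_(j < n) (complex.Re (z j 0) ^+ 2 + complex.Im (z j 0) ^+ 2)).

Definition measurable_field u : Prop := forall j,
  measurable_fun setT (fun x => complex.Re (u x j 0)) /\
  measurable_fun setT (fun x => complex.Im (u x j 0)).

Definition L2norm u : \bar R := Lnorm mu 2%:E (fun x => (cnorm (u x))%:E).

Definition in_L2 u : Prop := measurable_field u /\ (L2norm u < +oo)%E.

Definition expi (theta : R) : R[i] := (cos theta +i* sin theta)%C.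

Definition Cintegral (D : set (Rn R n)) (f : Rn R n -> R[i]) : R[i] :=
  ((\int[mu]_(x in D) complex.Re (f x)) +i* (\int[mu]_(x in D) complex.Im (f x)))%C.

Definition fourier_integral (D : set (Rn R n)) u (xi : Rn R n) : 'cV[R[i]]_n :=
  \col_j Cintegral D (fun x => expi (- dotn x xi) * u x j 0).

(* uhat represents the Fourier-Plancherel transform of u: the limit in L^2, as
   N tends to infinity, of the Fourier integrals of u restricted to B(N).
   By Plancherel's theorem it exists for every u in L^2, and it is unique up
   to a null set. *)
Definition is_fourier u uhat : Prop :=
  [/\ in_L2 u, in_L2 uhat &
      L2norm (fun xi => fourier_integral (ball0 N%:R) u xi - uhat xi)
        @[N --> \oo] --> 0%E].

(* P_r(u) = l; in particular, the limit exists in [0, +oo]. *)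
Definition decay_indicator u (r : R) (l : \bar R) : Prop :=
  exists2 uhat, is_fourier u uhat &
    ((rho `^ (- 2 * r - n%:R))%:E *
      \int[mu]_(xi in ball0 rho) ((cnorm (uhat xi) ^+ 2)%:E))%E
      @[rho --> 0^'+] --> l.

Definition finite_indicator u (r : R) : Prop :=
  - n%:R / 2 < r /\ exists2 l, decay_indicator u r l & (0 < l < +oo)%E.

Inductive decay_character u : \bar R -> Prop :=
| decay_character_fin r :
    unique (finite_indicator u) r -> decay_character u r%:E
| decay_character_min :
    ~ (exists r, finite_indicator u r) ->
    (forall r, - n%:R / 2 < r -> decay_indicator u r +oo%E) ->
    decay_character u (- n%:R / 2)%:E
| decay_character_infty :
    ~ (exists r, finite_indicator u r) ->
    (forall r, - n%:R / 2 < r -> decay_indicator u r 0%E) ->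
    decay_character u +oo%E.

(* The exponential series, entry by entry. *)
Definition mexp (A : 'M[R]_n) : 'M[R]_n :=
  \matrix_(i, j) limn (fun N => (\sum_(k < N) k`!%:R^-1 *: A ^+ k) i j).

(* w is the image of u under the pseudodifferential operator with symbol S. *)
Definition pseudodiff (S : Rn R n -> 'M[R]_n) u w : Prop :=
  exists uhat what, [/\ is_fourier u uhat, is_fourier w what &
    {ae mu, forall xi, what xi = map_mx (real_complex R) (S xi) *m uhat xi}].

(* The solution of v_t = L v, v(0) = v0, where L has symbol M: the Fourier
   transform of v(t) is e^{t M(xi)} v0hat(xi). At t = 0 this forces v 0 = v0
   almost everywhere. *)
Definition solution (M : Rn R n -> 'M[R]_n) (v0 : vfield R n)
    (v : R -> vfield R n) : Prop :=
  forall t, 0 <= t -> pseudodiff (fun xi => mexp (t *: M xi)) v0 (v t).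

Definition frac_diag (alpha : R) (c : 'I_n -> R) (xi : Rn R n) : 'M[R]_n :=
  \matrix_(i, j) (- c i * enorm xi `^ (2 * alpha) * (i == j)%:R).

End fields.

(* Main.v *)
From HB Require Import structures.
Require Import Defs.
From mathcomp Require Import all_boot all_order all_algebra.
From mathcomp Require Import complex.
From mathcomp Require Import all_classical all_reals all_analysis.
From mathcomp Require Import measurable_realfun ring lra.
Set Implicit Arguments.
Unset Strict Implicit.
Unset Printing Implicit Defensive.
Import Order.TTheory GRing.Theory Num.Theory.
Import numFieldNormedType.Exports.
Local Open Scope classical_set_scope.
Local Open Scope ring_scope.

(** In frequency the solution is [exp(t M(xi))] applied to the transform of the
    data. In the orthonormal frame [P(xi)] the symbol is diagonal with entries
    [- c_i |xi|^(2 alpha)], and an orthogonal change of frame preserves length;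
    hence [exp(t M(xi))] multiplies the squared length of a vector by a factor
    between [exp(- 2 c1 t |xi|^(2 alpha))] and [exp(- 2 c0 t |xi|^(2 alpha))],
    where [c1] bounds all the [c_i] ([cnorm_mexp_symbol]). By Plancherel's
    identity the squared norm of [v(t)] is, up to the factor [(2 pi)^n],
    squeezed between two integrals
    [\int exp(- k t |xi|^(2 alpha)) |uhat(xi)|^2 dxi], where [uhat] is the
    transform of the data ([solution_heat]).

    Such an integral is governed by the mass of [|uhat|^2] in small balls. If
    the ball of radius [rho] has mass at least [L rho^(2 alpha beta)], then on
    the ball of radius [rho ~ (1 + t)^(- 1 / (2 alpha))] the exponential is
    bounded below, and the integral is at least of order [(1 + t)^(- beta)]
    ([heat_lower]). If it has mass at most [K rho^(2 alpha beta)], the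
    shells where [k t |xi|^(2 alpha)] is about [j] contribute at most
    [exp(- j) (j + 1)^beta t^(- beta)] up to a constant, and the series over
    [j] converges ([heat_upper]). A positive decay indicator of order [r] gives
    the lower mass bound and a finite one the upper mass bound, with
    [2 r + n = 2 alpha beta]. The finite case takes both, with
    [beta = (n / 2 + r) / alpha]; in the two extreme cases the indicator is
    infinite, or zero, for every order, so [beta] is arbitrary.

    The indicator and the solution at each time come with their own versions of
    the transform, so the argument rests on two facts about the transform of a
    square-integrable field: it multiplies the squared norm by [(2 pi)^n]
    ([fourier_energy]) and it is determined almost everywhere
    ([fourier_unique]). Both follow from Plancherel's identity for integrable
    and square-integrable functions ([plancherel_tuple]), because truncation to
    a ball makes a square-integrable field integrable. On the line, weighting
    the squared modulus of the transform of [a] by [exp(- e xi)] on the half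
    line turns its integral into the quadratic form
    [\int \int a(x) a(y) e / (e^2 + (x - y)^2)], a constant multiple of
    [\int a^2] minus an average of the squared distances between [a] and its
    translates ([poisson_quadratic_formE]). The kernel concentrates at the
    origin as [e] tends to zero, and translation is continuous in the mean
    square, so the average vanishes in the limit. Products and [R^n] follow by
    Fubini's theorem and induction on the dimension. *)

(** * Lebesgue measure and the Poisson kernel *)

Section lebesgue_invariance.
Context {R : realType}.
Local Notation mu := (@lebesgue_measure R).

Lemma measurable_translation (z : R) :
  measurable_fun setT (fun x : measurableTypeR R => ((x : R) + z)%R : measurableTypeR R).
Proof. by apply: continuous_measurable_fun => x; apply: cvgD => //; exact: cvg_cst. Qed.

Lemma lebesgue_measure_translation (z : R) (A : set R) : measurable A ->
  pushforward mu (fun x : measurableTypeR R => ((x : R) + z)%R : measurableTypeR R) A = mu A.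
Proof.
move=> mA; apply/esym.
pose phi : {mfun measurableTypeR R >-> measurableTypeR R} :=
  HB.pack (fun x : measurableTypeR R => ((x : R) + z)%R : measurableTypeR R)
    (isMeasurableFun.Build _ _ (measurableTypeR R) (measurableTypeR R) _ (measurable_translation z)).
apply: (@lebesgue_measure_unique R (pushforward mu phi)) => //= _ [[a b]] _ <-.
rewrite /pushforward (_ : _ @^-1` _ = `]a - z, b - z]%classic); last first.
  by apply/seteqP; split => x /=; rewrite !in_itv/= ltrBlDr lerBrDr.
rewrite !lebesgue_measure_itv/= !lte_fin ltrD2r; case: ifP => // _.
by congr (_%:E); lra.
Qed.

Lemma ge0_integral_translation (z : R) (f : R -> \bar R) :
  measurable_fun setT f -> (forall x, 0 <= f x)%E ->
  (\int[mu]_x f ((x : R) + z)%R = \int[mu]_x f x)%E.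
Proof.
move=> mf f0.
transitivity (\int[pushforward mu (fun x : measurableTypeR R => ((x : R) + z)%R : measurableTypeR R)]_x f x)%E.
  by rewrite ge0_integral_pushforward//; exact: measurable_translation.
apply: eq_measure_integral => [|mz A mA _]; first exact: measurable_translation.
exact: lebesgue_measure_translation.
Qed.

Lemma ge0_integral_reflection (f : R -> \bar R) :
  measurable_fun setT f -> (forall x, 0 <= f x)%E ->
  (\int[mu]_x f (- (x : R))%R = \int[mu]_x f x)%E.
Proof.
move=> mf f0.
transitivity (\int[pushforward mu (-%R : _ -> measurableTypeR R)]_x f x)%E.
  by rewrite ge0_integral_pushforward//; exact: oppr_measurable.
by apply: eq_measure_integral => A mA _; exact: lebesgue_measureN.
Qed.

End lebesgue_invariance.

Section poisson_kernel.
Context {R : realType}.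
Local Notation mu := (@lebesgue_measure R).

(** The harmonic Poisson kernel of the half plane at height [e], without the
    factor [pi^-1]. *)
Definition poisson (e z : R) : R := e / (e ^+ 2 + z ^+ 2).

Lemma poisson_den_gt0 (e z : R) : 0 < e -> 0 < e ^+ 2 + z ^+ 2.
Proof. by move=> e0; rewrite ltr_pwDl ?sqr_ge0// exprn_gt0. Qed.

Lemma poisson_ge0 (e z : R) : 0 < e -> 0 <= poisson e z.
Proof. by move=> e0; rewrite divr_ge0// ltW// poisson_den_gt0. Qed.

Lemma poissonN (e z : R) : poisson e (- z) = poisson e z.
Proof. by rewrite /poisson sqrrN. Qed.

Lemma continuous_poisson (e : R) : 0 < e -> continuous (poisson e).
Proof.
move=> e0 z; apply: cvgM; first exact: cvg_cst.
apply: cvgV; first by rewrite gt_eqF// poisson_den_gt0.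
by apply: cvgD; [exact: cvg_cst|exact: exprn_continuous].
Qed.

(** The antiderivative is [atan (z / e)]. *)
Lemma integral_poisson (e : R) : 0 < e -> (\int[mu]_z (poisson e z)%:E = pi%:E)%E.
Proof.
move=> e0; rewrite ge0_symfun_integralT; first last.
- by move=> z /=; rewrite poissonN.
- exact: continuous_poisson.
- by move=> z; exact: poisson_ge0.
have datan (x : R) : is_derive x 1 (fun z => atan (z / e)) (poisson e x).
  have -> : poisson e x = e^-1 * (1 + (x / e) ^+ 2)^-1.
    by rewrite /poisson; field; rewrite !gt_eqF ?poisson_den_gt0// ltr_pwDl ?sqr_ge0// exprn_gt0.
  rewrite mulrC; apply: (@is_derive1_comp R atan (fun z => z / e)).
  by apply: is_derive_eq; rewrite scaler0 add0r /GRing.scale/= mulr1.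
rewrite -set_itvcy (@ge0_continuous_FTC2y _ (poisson e) (fun z => atan (z / e)) 0 (pi / 2)).
- rewrite mul0r atan0 sube0 -EFinM; congr (_%:E); lra.
- by move=> z _; exact: poisson_ge0.
- by apply: continuous_in_subspaceT => z _; exact: continuous_poisson.
- apply: (@cvg_comp _ _ _ (fun z : R => z / e) atan _ (pinfty_nbhs R)); last exact: cvgy_atan.
  by apply: gt0_cvgMly => //; rewrite invr_gt0.
- by move=> z _; apply: ex_derive.
- apply: cvg_at_right_filter; apply: continuous_comp; last exact: continuous_atan.
  by apply: cvgM; [exact: cvg_id|exact: cvg_cst].
- by move=> z _; rewrite derive1E derive_val.
Qed.

(** The integrand has an elementary antiderivative. The summand 1 makes it
    nonnegative, as the fundamental theorem on a half line requires; the value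
    at [z = 0] removes it again in [integral_abel_cos]. *)
Lemma integral_expR_cos (e z : R) : 0 < e ->
  (\int[mu]_(x in `[0%R, +oo[) (expR (- e * x) * (1 + cos (z * x)))%:E =
   (e^-1 + poisson e z)%:E)%E.
Proof.
move=> e0.
pose F x := - (expR (- e * x) * (e^-1 + (e * cos (z * x) - z * sin (z * x)) / (e ^+ 2 + z ^+ 2))).
have dF (x : R) : is_derive x 1 F (expR (- e * x) * (1 + cos (z * x))).
  apply: is_derive_eq; rewrite /GRing.scale/=.
  by field; rewrite !gt_eqF// poisson_den_gt0.
have -> : e^-1 + poisson e z = 0 - F 0.
  rewrite /F !mulr0 expR0 cos0 sin0 mulr0 subr0 mulr1 mul1r sub0r opprK; by [].
have cE : continuous (fun x => expR (- e * x) * (1 + cos (z * x))).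
  move=> x; apply: cvgM.
    apply: continuous_comp; last exact: continuous_expR.
    by apply: cvgM; [exact: cvg_cst|exact: cvg_id].
  apply: cvgD; first exact: cvg_cst.
  apply: continuous_comp; last exact: continuous_cos.
  by apply: cvgM; [exact: cvg_cst|exact: cvg_id].
rewrite (@ge0_continuous_FTC2y _ _ F 0 0).
- by [].
- by move=> x _; rewrite mulr_ge0 ?expR_ge0// -lerBlDl sub0r cos_geN1.
- by apply: continuous_in_subspaceT => x _; exact: cE.
- have K x : `|F x| <= (e^-1 + (e + `|z|) / (e ^+ 2 + z ^+ 2)) * expR (- (e * x)).
    rewrite normrN normrM ger0_norm ?expR_ge0// mulNr mulrC ler_wpM2r ?expR_ge0//.
    rewrite (le_trans (ler_normD _ _))// ger0_norm ?invr_ge0 ?(ltW e0)// lerD2l.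
    rewrite normrM normfV (gtr0_norm (poisson_den_gt0 _ e0)).
    rewrite ler_wpM2r ?invr_ge0 ?(ltW (poisson_den_gt0 _ e0))//.
    rewrite (le_trans (ler_normB _ _))// !normrM (gtr0_norm e0).
    by rewrite lerD// ler_piMr ?cos_max ?sin_max// ltW.
  have E0 : (e^-1 + (e + `|z|) / (e ^+ 2 + z ^+ 2)) * expR (- (e * x)) @[x --> +oo] --> 0.
    rewrite -[X in _ --> X](mulr0 (e^-1 + (e + `|z|) / (e ^+ 2 + z ^+ 2))).
    apply: cvgM; first exact: cvg_cst.
    apply: (@cvg_comp _ _ _ (fun x => e * x) (fun x => expR (- x)) _ (pinfty_nbhs R)).
      exact: gt0_cvgMry.
    exact: cvgr_expR.
  apply: norm_cvg0; apply: (squeeze_cvgr _ (cvg_cst 0) E0).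
  by apply: nearW => x; rewrite normr_ge0 K.
- by move=> x _; apply: ex_derive.
- by apply/cvg_at_right_filter/differentiable_continuous/derivable1_diffP/ex_derive.
- by move=> x _; rewrite derive1E derive_val.
Qed.

End poisson_kernel.

(** * Plancherel's identity with an exponential weight *)

Section measurable_trigo.
Context {R : realType}.

Lemma measurable_cos : measurable_fun setT (@cos R).
Proof. by apply: continuous_measurable_fun; exact: continuous_cos. Qed.

Lemma measurable_sin : measurable_fun setT (@sin R).
Proof. by apply: continuous_measurable_fun; exact: continuous_sin. Qed.

End measurable_trigo.

Section abel_weight.
Context {R : realType}.
Local Notation mu := (@lebesgue_measure R).

(** The weight that makes the integral of the squared transform converge
    absolutely, so that the order of integration can be exchanged; it tends to 1
    on the half line, and evenness accounts for the other half. *)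
Definition abel (e : R) : R -> R := (fun x => expR (- e * x)) \_ `[0%R, +oo[.

Lemma abel_ge0 (e x : R) : 0 <= abel e x.
Proof. by rewrite /abel patchE; case: ifP => // _; exact: expR_ge0. Qed.

Lemma measurable_abel (e : R) : measurable_fun setT (abel e).
Proof.
apply/measurable_restrict => //; apply: measurable_funTS.
by apply: measurableT_comp => //; exact: measurable_funM.
Qed.

Lemma integrable_abel (e : R) : 0 < e -> mu.-integrable setT (EFin \o abel e).
Proof.
move=> e0; apply/integrableP; split.
  by apply/measurable_EFinP; exact: measurable_abel.
under eq_integral do rewrite /= ger0_norm ?abel_ge0//.
have -> : (\int[mu]_x (abel e x)%:E = \int[mu]_(x in `[0%R, +oo[) (expR (- e * x))%:E)%E.
  by rewrite [RHS]integral_mkcond restrict_EFin.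
apply: (@le_lt_trans _ _ (e^-1 + poisson e 0)%:E); last exact: ltry.
rewrite -integral_expR_cos//; apply: ge0_le_integral => //.
- apply/measurable_EFinP; apply: measurable_funTS.
  by apply: measurableT_comp => //; exact: measurable_funM.
- apply/measurable_EFinP; apply: measurable_funTS; apply: measurable_funM.
    by apply: measurableT_comp => //; exact: measurable_funM.
  apply: measurable_funD => //.
  by apply: (measurableT_comp measurable_cos); exact: measurable_funM.
- by move=> x _; rewrite lee_fin mul0r cos0 ler_peMr ?expR_ge0// lerDl.
Qed.

Lemma integral_abel_cos (e z : R) : 0 < e ->
  (\int[mu]_x (abel e x * cos (z * x))%:E = (poisson e z)%:E)%E.
Proof.
move=> e0.
have mcos (c : R) : measurable_fun setT (fun x : R => cos (c * x)).
  by apply: (measurableT_comp measurable_cos); exact: measurable_funM.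
have ic (c : R) : mu.-integrable setT (EFin \o (fun x => abel e x * cos (c * x))).
  apply: (le_integrable _ _ _ (integrable_abel e0)) => //.
    by apply/measurable_EFinP; apply: measurable_funM; [exact: measurable_abel|exact: mcos].
  by move=> x _ /=; rewrite lee_fin normrM ler_piMr ?normr_ge0 ?cos_max.
have E (c : R) : \int[mu]_x abel e x + \int[mu]_x (abel e x * cos (c * x)) = e^-1 + poisson e c.
  rewrite -RintegralD//; last exact: integrable_abel.
  rewrite -[RHS]/(fine (e^-1 + poisson e c)%:E) -integral_expR_cos//; congr fine.
  rewrite [RHS]integral_mkcond; apply: eq_integral => x _.
  rewrite patchE /abel patchE; case: ifP => _; first by rewrite mulrDr mulr1.
  by rewrite mul0r addr0.
have E0 := E 0; have Ez := E z.
have p0 : poisson e 0 = e^-1 by rewrite /poisson expr0n addr0; field; rewrite gt_eqF.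
have c0 : \int[mu]_x (abel e x * cos (0 * x)) = \int[mu]_x abel e x.
  by apply: eq_Rintegral => x _; rewrite mul0r cos0 mulr1.
rewrite -[LHS]fineK ?integrable_fin_num//; last exact: (ic z).
rewrite -/(Rintegral _ _ _); congr (_%:E); move: E0 Ez; rewrite c0 p0.
move: (\int[mu]_x abel e x) (Rintegral _ _ _) => A B; clear; lra.
Qed.

End abel_weight.

Section product_functions.
Context d1 d2 (T1 : measurableType d1) (T2 : measurableType d2) {R : realType}.
Context (m1 : {sigma_finite_measure set T1 -> \bar R})
        (m2 : {sigma_finite_measure set T2 -> \bar R}).
Variables (f : T1 -> R) (g : T2 -> R).
Hypotheses (if1 : m1.-integrable setT (EFin \o f)) (ig : m2.-integrable setT (EFin \o g)).

Lemma integrable_prod_fun :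
  (m1 \x m2)%E.-integrable setT (fun p => (f p.1 * g p.2)%:E).
Proof.
have mf : measurable_fun setT f by apply/measurable_EFinP; exact: measurable_int if1.
have mg : measurable_fun setT g by apply/measurable_EFinP; exact: measurable_int ig.
apply/integrable12ltyP.
  by apply/measurable_EFinP; apply: measurable_funM; exact: measurableT_comp.
have ng : (0 <= \int[m2]_y `|(g y)%:E| < +oo)%E.
  by rewrite integral_ge0//=; case/integrableP : ig.
have fg : (\int[m2]_y `|(g y)%:E|)%E \is a fin_num.
  by rewrite ge0_fin_numE; case/andP : ng.
under eq_integral => x _.
  rewrite /=; under eq_integral do rewrite normrM EFinM.
  rewrite ge0_integralZl//; last by do 2 apply: measurableT_comp => //.
  over.
rewrite ge0_integralZr//; first last.
- by case/andP: ng.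
- by do 2 apply: measurableT_comp => //.
apply: lte_mul_pinfty; [exact: integral_ge0| |by case/andP : ng].
by rewrite ge0_fin_numE ?integral_ge0//; case/integrableP : if1.
Qed.

End product_functions.

Section parameter_integral.
Context d1 d2 (T1 : measurableType d1) (T2 : measurableType d2) {R : realType}.
Context (m2 : {sigma_finite_measure set T2 -> \bar R}).

Lemma measurable_integral_param (h : T1 * T2 -> \bar R) : measurable_fun setT h ->
  measurable_fun setT (fun x => \int[m2]_y h (x, y))%E.
Proof.
move=> mh.
rewrite (_ : (fun _ => _) = (fun x => \int[m2]_y h^\+ (x, y) - \int[m2]_y h^\- (x, y))%E).
  apply: emeasurable_funB; apply: measurable_fun_fubini_tonelli_F => //.
    exact: measurable_funepos.
  exact: measurable_funeneg.
apply/funext => x; rewrite integralE; congr (_ - _)%E; apply: eq_integral => y _.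
  by rewrite funepos_comp.
by rewrite funeneg_comp.
Qed.

Lemma measurable_Rintegral_param (h : T1 * T2 -> R) : measurable_fun setT h ->
  measurable_fun setT (fun x => \int[m2]_y h (x, y)).
Proof.
move=> mh; apply: (measurableT_comp (fine_measurable measurableT)).
by apply: (@measurable_integral_param (EFin \o h)); exact/measurable_EFinP.
Qed.

End parameter_integral.

Section integrable_mul.
Context d (T : measurableType d) {R : realType}.

Lemma integrable_mul_bounded (m : {measure set T -> \bar R}) (f h : T -> R) (K : R) :
  m.-integrable setT (EFin \o f) -> measurable_fun setT h -> (forall x, `|h x| <= K) ->
  m.-integrable setT (EFin \o (fun x => f x * h x)).
Proof.
move=> if1 mh hK.
have mf : measurable_fun setT f by apply/measurable_EFinP; exact: measurable_int if1.
apply: (le_integrable _ _ _ (integrableZl measurableT K if1)) => //.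
  by apply/measurable_EFinP; exact: measurable_funM.
move=> x _ /=; rewrite lee_fin !normrM mulrC ler_wpM2r//.
by rewrite (le_trans (hK x))// ler_norm.
Qed.

End integrable_mul.

Section bounded_kernel.
Context d1 d2 (T1 : measurableType d1) (T2 : measurableType d2) {R : realType}.

Context (m1 : {sigma_finite_measure set T1 -> \bar R})
        (m2 : {sigma_finite_measure set T2 -> \bar R}).

(** The symmetric form of Fubini's theorem used for Fourier kernels: each of the
    two variables carries an integrable weight. *)
Lemma Fubini_bounded_kernel (f : T1 -> R) (g : T2 -> R) (k : T1 * T2 -> R) (K : R) :
  m1.-integrable setT (EFin \o f) -> m2.-integrable setT (EFin \o g) ->
  measurable_fun setT k -> (forall p, `|k p| <= K) ->
  (\int[m1]_x ((f x)%:E * \int[m2]_y (g y * k (x, y))%:E) =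
   \int[m2]_y ((g y)%:E * \int[m1]_x (f x * k (x, y))%:E))%E.
Proof.
move=> if1 ig mk kK.
have mf : measurable_fun setT f by apply/measurable_EFinP; exact: measurable_int if1.
have mg : measurable_fun setT g by apply/measurable_EFinP; exact: measurable_int ig.
have ifgk : (m1 \x m2)%E.-integrable setT (fun p => (f p.1 * g p.2 * k p)%:E).
  apply: (le_integrable _ _ _ (integrableZl measurableT K (integrable_prod_fun if1 ig))) => //.
    apply/measurable_EFinP; apply: measurable_funM => //.
    by apply: measurable_funM; exact: measurableT_comp.
  move=> p _ /=; rewrite lee_fin normrM mulrC [leRHS]normrM ler_wpM2r//.
  by rewrite (le_trans (kK p))// ler_norm.
transitivity (\int[m1]_x \int[m2]_y (f x * g y * k (x, y))%:E)%E.
  apply: eq_integral => x _; rewrite -integralZl//=.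
    by apply: eq_integral => y _; rewrite -EFinM mulrA.
  apply: (@integrable_mul_bounded _ _ _ _ _ _ K) => //.
  by apply: (measurableT_comp mk); exact: pair1_measurable.
rewrite (Fubini ifgk); apply: eq_integral => y _; rewrite -integralZl//=.
  by apply: eq_integral => x _; rewrite -EFinM mulrA (mulrC (f x)).
apply: (@integrable_mul_bounded _ _ _ _ _ _ K) => //.
by apply: (measurableT_comp mk); exact: pair2_measurable.
Qed.

End bounded_kernel.

Section abel_transform.
Context {R : realType}.
Local Notation mu := (@lebesgue_measure R).
Variable a : R -> R.
Hypothesis ia : mu.-integrable setT (EFin \o a).

Definition cosine_transform (xi : R) : R := \int[mu]_x (a x * cos (x * xi)).
Definition sine_transform (xi : R) : R := \int[mu]_x (a x * sin (x * xi)).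

Local Notation C := cosine_transform.
Local Notation S := sine_transform.

Let ma : measurable_fun setT a.
Proof. by apply/measurable_EFinP; exact: measurable_int ia. Qed.

Let mtrig (xi : R) : (measurable_fun setT (fun x : R => cos (x * xi))) *
  (measurable_fun setT (fun x : R => sin (x * xi))).
Proof.
by split; [apply: (measurableT_comp measurable_cos)|apply: (measurableT_comp measurable_sin)];
  exact: measurable_funM.
Qed.

Lemma measurable_cosine_transform : measurable_fun setT C.
Proof.
apply: (@measurable_Rintegral_param _ _ _ _ _ mu (fun p : R * R => a p.2 * cos (p.2 * p.1))).
apply: measurable_funM; first exact: measurableT_comp.
by apply: (measurableT_comp measurable_cos); exact: measurable_funM.
Qed.

Lemma measurable_sine_transform : measurable_fun setT S.
Proof.
apply: (@measurable_Rintegral_param _ _ _ _ _ mu (fun p : R * R => a p.2 * sin (p.2 * p.1))).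
apply: measurable_funM; first exact: measurableT_comp.
by apply: (measurableT_comp measurable_sin); exact: measurable_funM.
Qed.

Let icos (xi : R) : mu.-integrable setT (EFin \o (fun x => a x * cos (x * xi))).
Proof. by apply: integrable_mul_bounded ia (mtrig xi).1 _ => x; exact: cos_max. Qed.

Let isin (xi : R) : mu.-integrable setT (EFin \o (fun x => a x * sin (x * xi))).
Proof. by apply: integrable_mul_bounded ia (mtrig xi).2 _ => x; exact: sin_max. Qed.

Lemma norm_cosine_transform (xi : R) : `|C xi| <= \int[mu]_x `|a x|.
Proof.
apply: le_trans (le_normr_Rintegral _ (icos xi)) _ => //; apply: le_Rintegral => //.
- exact: integrable_norm.
- exact: integrable_norm.
- by move=> x _; rewrite normrM ler_piMr ?cos_max.
Qed.

Lemma norm_sine_transform (xi : R) : `|S xi| <= \int[mu]_x `|a x|.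
Proof.
apply: le_trans (le_normr_Rintegral _ (isin xi)) _ => //; apply: le_Rintegral => //.
- exact: integrable_norm.
- exact: integrable_norm.
- by move=> x _; rewrite normrM ler_piMr ?sin_max.
Qed.

(* [C xi] and [S xi] are integrals in [y]; together with the trigonometric
   functions of [x * xi] they form the cosine of the difference. *)
Let k (q : R * R) : R := cos (q.2 * q.1) * C q.1 + sin (q.2 * q.1) * S q.1.

Let kE (xi x : R) : k (xi, x) = \int[mu]_y (a y * cos ((x - y) * xi)).
Proof.
rewrite /k /= /C /S -!RintegralZl// -RintegralD//.
- by apply: eq_Rintegral => y _; rewrite mulrBl cosB; ring.
- by apply: (integrableZl measurableT (cos (x * xi)) (icos xi)).
- by apply: (integrableZl measurableT (sin (x * xi)) (isin xi)).
Qed.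

(** Exchanging the integrals twice brings the frequency inside, where the
    weighted integral of [cos ((x - y) * xi)] is the Poisson kernel. *)
Lemma integral_abel_sqr_transform (e : R) : 0 < e ->
  (\int[mu]_xi (abel e xi * (C xi ^+ 2 + S xi ^+ 2))%:E =
   \int[mu]_x ((a x)%:E * \int[mu]_y (a y * poisson e (x - y))%:E))%E.
Proof.
move=> e0.
have mk : measurable_fun setT k.
  apply: measurable_funD; apply: measurable_funM.
  - by apply: (measurableT_comp measurable_cos); exact: measurable_funM.
  - exact: (measurableT_comp measurable_cosine_transform).
  - by apply: (measurableT_comp measurable_sin); exact: measurable_funM.
  - exact: (measurableT_comp measurable_sine_transform).
have bk q : `|k q| <= 2 * \int[mu]_x `|a x|.
  rewrite (le_trans (ler_normD _ _))// mulr_natl mulr2n lerD// normrM.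
    by rewrite (le_trans _ (norm_cosine_transform q.1))// ler_piMl ?cos_max.
  by rewrite (le_trans _ (norm_sine_transform q.1))// ler_piMl ?sin_max.
transitivity (\int[mu]_xi ((abel e xi)%:E * \int[mu]_x (a x * k (xi, x))%:E))%E.
  apply: eq_integral => xi _; rewrite EFinM; congr (_ * _)%E.
  have ik : mu.-integrable setT (EFin \o (fun x => a x * k (xi, x))).
    apply: integrable_mul_bounded ia _ (fun x => bk (xi, x)).
    by apply: (measurableT_comp mk); exact: pair1_measurable.
  rewrite -[RHS]fineK; last exact: integrable_fin_num ik.
  congr (_%:E); rewrite /k/= !expr2 {1}/C {1}/S -!RintegralZr// -RintegralD//.
  - by apply: eq_Rintegral => x _; ring.
  - exact: (integrableZr measurableT (C xi) (icos xi)).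
  - exact: (integrableZr measurableT (S xi) (isin xi)).
rewrite (Fubini_bounded_kernel (integrable_abel e0) ia mk bk).
apply: eq_integral => x _; congr (_ * _)%E.
transitivity (\int[mu]_xi ((abel e xi)%:E * \int[mu]_y (a y * cos ((x - y) * xi))%:E))%E.
  apply: eq_integral => xi _; rewrite EFinM kE fineK//.
  apply: integrable_fin_num => //; apply: integrable_mul_bounded ia _ (fun y => cos_max _).
  apply: (measurableT_comp measurable_cos); apply: measurable_funM => //.
  exact: measurable_funB.
rewrite (@Fubini_bounded_kernel _ _ _ _ _ mu mu _ _ (fun q => cos ((x - q.2) * q.1)) 1 (integrable_abel e0) ia)/=.
- by apply: eq_integral => y _; rewrite integral_abel_cos.
- apply: (measurableT_comp measurable_cos); apply: measurable_funM => //.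
  exact: measurable_funB.
- by move=> q; exact: cos_max.
Qed.

End abel_transform.

(** * The Poisson quadratic form *)

Section translation_defect.
Context {R : realType}.
Local Notation mu := (@lebesgue_measure R).

Definition translation_defect (a : R -> R) (z : R) : \bar R :=
  (\int[mu]_x ((a x - a (x + z)) ^+ 2)%:E)%E.

Lemma translation_defect_ge0 a z : (0 <= translation_defect a z)%E.
Proof. by apply: integral_ge0 => x _; rewrite lee_fin sqr_ge0. Qed.

Lemma measurable_comp_translation (a : R -> R) (z : R) :
  measurable_fun setT a -> measurable_fun setT (fun x : R => a (x + z)).
Proof. by move=> ma; apply: (measurableT_comp ma); exact: measurable_funD. Qed.

Lemma integral_sqr_translation (a : R -> R) (z : R) : measurable_fun setT a ->
  (\int[mu]_x (a ((x : R) + z)%R ^+ 2)%:E = \int[mu]_x (a x ^+ 2)%:E)%E.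
Proof.
move=> ma; apply: (ge0_integral_translation z (f := fun x => (a x ^+ 2)%:E)).
  by apply/measurable_EFinP; exact: measurable_funX.
by move=> x; rewrite lee_fin sqr_ge0.
Qed.

(** From [(p - q)^2 <= 2 p^2 + 2 q^2] and the invariance of the measure. *)
Lemma translation_defect_le (a : R -> R) (z : R) : measurable_fun setT a ->
  (translation_defect a z <= 4%:E * \int[mu]_x (a x ^+ 2)%:E)%E.
Proof.
move=> ma; have maz := measurable_comp_translation z ma.
have m2 (b : R -> R) : measurable_fun setT b ->
  measurable_fun setT (fun x => (2 * b x ^+ 2)%:E).
  by move=> mb; apply/measurable_EFinP; apply: measurable_funM => //; exact: measurable_funX.
apply: (@le_trans _ _ (\int[mu]_x ((2 * a x ^+ 2)%:E + (2 * a ((x : R) + z)%R ^+ 2)%:E))%E).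
  apply: ge0_le_integral => //.
  - by move=> x _; rewrite lee_fin sqr_ge0.
  - by apply/measurable_EFinP; apply: measurable_funX; exact: measurable_funB.
  - by apply: emeasurable_funD; exact: m2.
  - move=> x _; rewrite -EFinD lee_fin -subr_ge0.
    by rewrite (_ : _ - _ = (a x + a (x + z)) ^+ 2) ?sqr_ge0//; ring.
have ge2 (b : R -> R) x : (0 <= (2 * b x ^+ 2)%:E)%E by rewrite lee_fin mulr_ge0// sqr_ge0.
have ge1 (b : R -> R) x : (0 <= (b x ^+ 2)%:E)%E by rewrite lee_fin sqr_ge0.
have m1 (b : R -> R) : measurable_fun setT b -> measurable_fun setT (fun x => (b x ^+ 2)%:E).
  by move=> mb; apply/measurable_EFinP; exact: measurable_funX.
rewrite ge0_integralD//; [|exact: m2|exact: (m2 (fun x : R => a (x + z)))].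
under eq_integral do rewrite EFinM.
under [X in (_ + X)%E]eq_integral do rewrite EFinM.
rewrite !ge0_integralZl//; [|exact: (m1 (fun x : R => a (x + z)))|exact: m1].
by rewrite integral_sqr_translation// -ge0_muleDl// -EFinD lee_wpmul2r ?integral_ge0// lee_fin; lra.
Qed.

End translation_defect.

Section poisson_quadratic_form.
Context {R : realType}.
Local Notation mu := (@lebesgue_measure R).
Variable a : R -> R.
Hypothesis ia : mu.-integrable setT (EFin \o a).
Hypothesis ia2 : mu.-integrable setT (EFin \o (fun x => a x ^+ 2)).

Let ma : measurable_fun setT a.
Proof. by apply/measurable_EFinP; exact: measurable_int ia. Qed.

Lemma measurable_poisson (e : R) : 0 < e -> measurable_fun setT (poisson e).
Proof. by move=> e0; apply: continuous_measurable_fun; exact: continuous_poisson. Qed.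

Lemma integral_poissonB (e x : R) : 0 < e ->
  (\int[mu]_y (poisson e (x - y))%:E = pi%:E)%E.
Proof.
move=> e0; have mP : measurable_fun setT (fun y => (poisson e y)%:E).
  by apply/measurable_EFinP; exact: measurable_poisson.
have P0 y : (0 <= (poisson e y)%:E)%E by rewrite lee_fin poisson_ge0.
rewrite -(integral_poisson e0) -(ge0_integral_translation (- x) mP P0).
by apply: eq_integral => y _; rewrite -poissonN opprB.
Qed.

Let f1 (e : R) (p : R * R) : R := a p.1 ^+ 2 * poisson e (p.1 - p.2).
Let f2 (e : R) (p : R * R) : R := a p.2 ^+ 2 * poisson e (p.1 - p.2).
Let f12 (e : R) (p : R * R) : R := a p.1 * a p.2 * poisson e (p.1 - p.2).

Let mPB (e : R) : 0 < e -> measurable_fun setT (fun p : R * R => poisson e (p.1 - p.2)).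
Proof. by move=> e0; apply: (measurableT_comp (measurable_poisson e0)); exact: measurable_funB. Qed.

Let mf1 e : 0 < e -> measurable_fun setT (f1 e).
Proof.
move=> e0; apply: measurable_funM (mPB e0); apply: measurable_funX; exact: measurableT_comp.
Qed.

Let mf2 e : 0 < e -> measurable_fun setT (f2 e).
Proof.
move=> e0; apply: measurable_funM (mPB e0); apply: measurable_funX; exact: measurableT_comp.
Qed.

Let mf12 e : 0 < e -> measurable_fun setT (f12 e).
Proof.
by move=> e0; apply: measurable_funM (mPB e0); apply: measurable_funM; exact: measurableT_comp.
Qed.

Let I2 := \int[mu]_x (a x ^+ 2).

Let I2E : (\int[mu]_x (a x ^+ 2)%:E = I2%:E)%E.
Proof. by rewrite /I2 /Rintegral fineK//; exact: integrable_fin_num ia2. Qed.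

Let f1_ge0 e p : 0 < e -> 0 <= f1 e p.
Proof. by move=> e0; rewrite mulr_ge0 ?sqr_ge0 ?poisson_ge0. Qed.

Let f2_ge0 e p : 0 < e -> 0 <= f2 e p.
Proof. by move=> e0; rewrite mulr_ge0 ?sqr_ge0 ?poisson_ge0. Qed.

Let int_f1 e : 0 < e -> (\int[mu \x mu]_p (f1 e p)%:E = (I2 * pi)%:E)%E.
Proof.
move=> e0; rewrite fubini_tonelli1//=; last 2 first.
- by apply/measurable_EFinP; exact: mf1.
- by move=> p; rewrite lee_fin f1_ge0.
rewrite /fubini_F/=.
under eq_integral => x _.
  under eq_integral do rewrite /f1/= EFinM.
  rewrite ge0_integralZl//; last 3 first.
  - by apply/measurable_EFinP; apply: (measurableT_comp (measurable_poisson e0)); exact: measurable_funB.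
  - by move=> y _; rewrite lee_fin poisson_ge0.
  - by rewrite lee_fin sqr_ge0.
  rewrite integral_poissonB//; over.
rewrite ge0_integralZr//; last 3 first.
- by apply/measurable_EFinP; exact: measurable_funX.
- by move=> x _; rewrite lee_fin sqr_ge0.
- by rewrite lee_fin pi_ge0.
by rewrite I2E EFinM.
Qed.

Let int_f2 e : 0 < e -> (\int[mu \x mu]_p (f2 e p)%:E = (I2 * pi)%:E)%E.
Proof.
move=> e0; rewrite fubini_tonelli2//=; last 2 first.
- by apply/measurable_EFinP; exact: mf2.
- by move=> p; rewrite lee_fin f2_ge0.
rewrite /fubini_G/=.
under eq_integral => y _.
  under eq_integral do rewrite /f2/= EFinM -poissonN opprB.
  rewrite ge0_integralZl//; last 3 first.
  - by apply/measurable_EFinP; apply: (measurableT_comp (measurable_poisson e0)); exact: measurable_funB.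
  - by move=> x _; rewrite lee_fin poisson_ge0.
  - by rewrite lee_fin sqr_ge0.
  rewrite integral_poissonB//; over.
rewrite ge0_integralZr//; last 3 first.
- by apply/measurable_EFinP; exact: measurable_funX.
- by move=> x _; rewrite lee_fin sqr_ge0.
- by rewrite lee_fin pi_ge0.
by rewrite I2E EFinM.
Qed.

Let if1 e : 0 < e -> (mu \x mu)%E.-integrable setT (EFin \o f1 e).
Proof.
move=> e0; apply/integrableP; split; first by apply/measurable_EFinP; exact: mf1.
under eq_integral do rewrite /= ger0_norm ?f1_ge0//.
by rewrite int_f1// ltry.
Qed.

Let if2 e : 0 < e -> (mu \x mu)%E.-integrable setT (EFin \o f2 e).
Proof.
move=> e0; apply/integrableP; split; first by apply/measurable_EFinP; exact: mf2.
under eq_integral do rewrite /= ger0_norm ?f2_ge0//.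
by rewrite int_f2// ltry.
Qed.

Let if12 e : 0 < e -> (mu \x mu)%E.-integrable setT (EFin \o f12 e).
Proof.
move=> e0; apply: (le_integrable _ _ _ (integrableD measurableT (if1 e0) (if2 e0))) => //.
  by apply/measurable_EFinP; exact: mf12.
move=> p _ /=; rewrite lee_fin [leRHS]ger0_norm ?addr_ge0 ?f1_ge0 ?f2_ge0//.
rewrite /f12 /f1 /f2 -mulrDl [leLHS]normrM (ger0_norm (poisson_ge0 _ e0)) ler_wpM2r ?poisson_ge0//.
rewrite ler_norml; apply/andP; split; rewrite -subr_ge0.
  rewrite (_ : _ - _ = (a p.1 ^+ 2 + a p.2 ^+ 2 + (a p.1 + a p.2) ^+ 2) / 2); last by field.
  by rewrite divr_ge0// !addr_ge0 ?sqr_ge0.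
rewrite (_ : _ - _ = (a p.1 ^+ 2 + a p.2 ^+ 2 + (a p.1 - a p.2) ^+ 2) / 2); last by field.
by rewrite divr_ge0// !addr_ge0 ?sqr_ge0.
Qed.

Let int_f12 e : 0 < e -> (\int[mu]_x ((a x)%:E * \int[mu]_y (a y * poisson e (x - y))%:E) =
  (\int[(mu \x mu)%E]_p f12 e p)%:E)%E.
Proof.
move=> e0; rewrite /Rintegral fineK; last by apply: integrable_fin_num => //; exact: if12.
rewrite -(integral12_prod_meas1 (if12 e0)) /fubini_F; apply: eq_integral => x _ /=.
rewrite -integralZl//=.
  by apply: eq_integral => y _; rewrite -EFinM mulrA.
apply: (@integrable_mul_bounded _ _ _ _ _ _ e^-1) => //.
  by apply: (measurableT_comp (measurable_poisson e0)); exact: measurable_funB.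
move=> y; rewrite ger0_norm ?poisson_ge0// /poisson ler_pdivrMr ?poisson_den_gt0//.
by rewrite mulrDr expr2 mulrA mulVf ?gt_eqF// mul1r lerDl mulr_ge0 ?sqr_ge0// invr_ge0 ltW.
Qed.

(** Polarization: [2 a(x) a(y) = a(x)^2 + a(y)^2 - (a(x) - a(y))^2]. Each square
    alone integrates against the kernel to [pi] times the integral of [a^2], and
    the substitution [y = x + z] turns the last term into translation defects. *)
Lemma poisson_quadratic_formE (e : R) : 0 < e ->
  (\int[mu]_x ((a x)%:E * \int[mu]_y (a y * poisson e (x - y))%:E) =
   (I2 * pi)%:E - 2^-1%:E * \int[mu]_z ((poisson e z)%:E * translation_defect a z))%E.
Proof.
move=> e0.
have mfd : measurable_fun setT (fun p : R * R => (f1 e p + f2 e p - 2 * f12 e p)%:E).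
  apply/measurable_EFinP; apply: measurable_funB.
    by apply: measurable_funD; [exact: mf1|exact: mf2].
  by apply: measurable_funM => //; exact: mf12.
have fdE p : f1 e p + f2 e p - 2 * f12 e p = (a p.1 - a p.2) ^+ 2 * poisson e (p.1 - p.2).
  by rewrite /f1 /f2 /f12; ring.
have fd_ge0 p : (0 <= (f1 e p + f2 e p - 2 * f12 e p)%:E)%E.
  by rewrite fdE lee_fin mulr_ge0 ?sqr_ge0 ?poisson_ge0.
have mz z : measurable_fun setT (fun x : R => ((a x - a (x + z)) ^+ 2)%:E).
  apply/measurable_EFinP; apply: measurable_funX; apply: measurable_funB => //.
  exact: measurable_comp_translation.
have mzx : measurable_fun setT (fun q : R * R => (poisson e q.1 * (a q.2 - a (q.2 + q.1)) ^+ 2)%:E).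
  apply/measurable_EFinP; apply: measurable_funM.
    exact: (measurableT_comp (measurable_poisson e0)).
  apply: measurable_funX; apply: measurable_funB; first exact: measurableT_comp.
  by apply: (measurableT_comp ma); exact: measurable_funD.
have -> : (\int[mu]_z ((poisson e z)%:E * translation_defect a z) =
   \int[mu \x mu]_p (f1 e p + f2 e p - 2 * f12 e p)%:E)%E.
  transitivity (\int[mu]_z \int[mu]_x (poisson e z * (a x - a ((x : R) + z)%R) ^+ 2)%:E)%E.
    apply: eq_integral => z _; rewrite /translation_defect -ge0_integralZl//.
    - exact: mz.
    - by move=> x _; rewrite lee_fin sqr_ge0.
    - by rewrite lee_fin poisson_ge0.
  have mzx_ge0 (q : R * R) : (0 <= (poisson e q.1 * (a q.2 - a (q.2 + q.1)) ^+ 2)%:E)%E.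
    by rewrite lee_fin mulr_ge0 ?poisson_ge0 ?sqr_ge0.
  transitivity (\int[mu]_x \int[mu]_z (poisson e z * (a x - a ((x : R) + z)%R) ^+ 2)%:E)%E.
    exact: (@fubini_tonelli _ _ _ _ _ mu mu _ mzx mzx_ge0).
  transitivity (\int[mu]_x \int[mu]_y (f1 e (x, y) + f2 e (x, y) - 2 * f12 e (x, y))%:E)%E; last first.
    by apply/esym; exact: (@fubini_tonelli1 _ _ _ _ _ mu mu _ mfd fd_ge0).
  apply: eq_integral => x _.
  have mfdx : measurable_fun setT (fun y : R => (f1 e (x, y) + f2 e (x, y) - 2 * f12 e (x, y))%:E).
    by apply: (measurableT_comp mfd); exact: pair1_measurable.
  rewrite -(ge0_integral_translation x mfdx); last by move=> y; exact: (fd_ge0 (x, y)).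
  apply: eq_integral => z _; rewrite fdE/= mulrC; congr (_ * _)%:E.
    by rewrite (addrC (z : R)).
  by rewrite -poissonN; congr (poisson e); ring.
have E : \int[(mu \x mu)%E]_p (f1 e p + f2 e p - 2 * f12 e p) =
    2 * (I2 * pi) - 2 * \int[(mu \x mu)%E]_p f12 e p.
  have i12 := if12 e0.
  rewrite RintegralB//; last 2 first.
  - exact: (integrableD measurableT (if1 e0) (if2 e0)).
  - exact: (integrableZl measurableT 2 i12).
  rewrite RintegralD//; [|exact: if1|exact: if2].
  rewrite RintegralZl// {1 2}/Rintegral int_f1// int_f2//=; ring.
rewrite int_f12// -[X in (_ * X)%E]fineK; last first.
  apply: integrable_fin_num => //.
  exact: (integrableB measurableT (integrableD measurableT (if1 e0) (if2 e0))
    (integrableZl measurableT 2 (if12 e0))).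
rewrite -/(Rintegral _ _ _) E -EFinM -EFinB; congr (_%:E); by field.
Qed.

End poisson_quadratic_form.

(** * Continuity of translation in the mean square *)

Section translation_continuity.
Context {R : realType}.
Local Notation mu := (@lebesgue_measure R).

(** Continuity at 0 of the translates of [a] in the mean square, in the
    quantitative form that survives sums, multiples and limits. *)
Definition vanishing_translation_defect (a : R -> R) := forall eta : R, 0 < eta ->
  exists2 delta : R, 0 < delta &
    forall z, `|z| < delta -> (translation_defect a z <= eta%:E)%E.

Lemma translation_defectD (a b : R -> R) (z : R) :
  measurable_fun setT a -> measurable_fun setT b ->
  (translation_defect (fun x => a x + b x)%R z <=
   2%:E * translation_defect a z + 2%:E * translation_defect b z)%E.
Proof.
move=> ma mb.
have mab (u : R -> R) : measurable_fun setT u ->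
    measurable_fun setT (fun x : R => ((u x - u (x + z)) ^+ 2)%:E).
  move=> mu; apply/measurable_EFinP; apply: measurable_funX; apply: measurable_funB => //.
  exact: measurable_comp_translation.
have ge0 (u : R -> R) (x : R) : (0 <= ((u x - u (x + z)) ^+ 2)%:E)%E.
  by rewrite lee_fin sqr_ge0.
rewrite /translation_defect -!ge0_integralZl//; [|exact: mab|exact: mab].
have ge2 (u : R -> R) (x : R) : (0 <= 2%:E * ((u x - u (x + z)) ^+ 2)%:E)%E by rewrite mule_ge0.
rewrite -ge0_integralD//; last 2 first.
- exact: (measurable_funeM _ (mab _ ma)).
- exact: (measurable_funeM _ (mab _ mb)).
apply: ge0_le_integral => //.
- by move=> x _; rewrite lee_fin sqr_ge0.
- by apply: mab; exact: measurable_funD.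
- exact: (emeasurable_funD (measurable_funeM _ (mab _ ma)) (measurable_funeM _ (mab _ mb))).
move=> x _; rewrite -!EFinM -EFinD lee_fin -subr_ge0.
rewrite (_ : _ - _ = ((a x - a (x + z)) - (b x - b (x + z))) ^+ 2) ?sqr_ge0//; ring.
Qed.

Lemma vanishing_translation_defectD (a b : R -> R) :
  measurable_fun setT a -> measurable_fun setT b ->
  vanishing_translation_defect a -> vanishing_translation_defect b ->
  vanishing_translation_defect (fun x => a x + b x).
Proof.
move=> ma mb va vb eta eta0.
have e4 : 0 < eta / 4 by rewrite divr_gt0.
have [d1 d10 h1] := va _ e4; have [d2 d20 h2] := vb _ e4.
exists (Num.min d1 d2); first by rewrite lt_min d10.
move=> z; rewrite lt_min => /andP[z1 z2].
apply: le_trans (translation_defectD z ma mb) _.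
rewrite (_ : eta%:E = 2%:E * (eta / 4)%:E + 2%:E * (eta / 4)%:E)%E; last first.
  by rewrite -!EFinM -EFinD; congr (_%:E); field.
by apply: leeD; apply: lee_wpmul2l; rewrite ?h1 ?h2.
Qed.

Lemma vanishing_translation_defectZ (k : R) (a : R -> R) :
  measurable_fun setT a ->
  vanishing_translation_defect a -> vanishing_translation_defect (fun x => k * a x).
Proof.
move=> ma va eta eta0.
have k0 : 0 < k ^+ 2 + 1 by rewrite ltr_wpDl ?sqr_ge0.
have [d d0 h] := va (eta / (k ^+ 2 + 1)) (divr_gt0 eta0 k0).
exists d => // z zd; rewrite /translation_defect.
under eq_integral do rewrite -mulrBr exprMn EFinM.
rewrite ge0_integralZl//; last 3 first.
- apply/measurable_EFinP; apply: measurable_funX; apply: measurable_funB => //.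
  exact: measurable_comp_translation.
- by move=> x _; rewrite lee_fin sqr_ge0.
- by rewrite lee_fin sqr_ge0.
apply: (@le_trans _ _ ((k ^+ 2 + 1)%:E * (eta / (k ^+ 2 + 1))%:E)%E).
  apply: lee_pmul => //; first by rewrite lee_fin sqr_ge0.
  - exact: translation_defect_ge0.
  - by rewrite lee_fin lerDl.
  - exact: h.
by rewrite -EFinM lee_fin mulrC divfK// gt_eqF.
Qed.

Lemma vanishing_translation_defect0 : vanishing_translation_defect (fun=> 0).
Proof.
move=> eta eta0; exists 1 => // z _; rewrite /translation_defect.
under eq_integral do rewrite subr0 expr0n.
by rewrite integral0 lee_fin ltW.
Qed.

(** The defect of [a - b] is at most four times the squared distance from [a] to
    [b], uniformly in the translation. *)
Lemma vanishing_translation_defect_closed (a : R -> R) : measurable_fun setT a ->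
  (forall eta : R, 0 < eta -> exists b : R -> R,
    [/\ measurable_fun setT b, vanishing_translation_defect b &
     (\int[mu]_x ((a x - b x) ^+ 2)%:E <= eta%:E)%E]) ->
  vanishing_translation_defect a.
Proof.
move=> ma H eta eta0.
have e0 : 0 < eta / 16 by rewrite divr_gt0.
have e4 : 0 < eta / 4 by rewrite divr_gt0.
have [b [mb vb ab]] := H _ e0; have [d d0 h] := vb _ e4.
exists d => // z zd.
have mab : measurable_fun setT (fun x => a x - b x) by exact: measurable_funB.
have -> : a = (fun x => b x + (a x - b x)) by apply/funext => x; rewrite addrC subrK.
apply: le_trans (translation_defectD z mb mab) _.
rewrite (_ : eta%:E = 2%:E * (eta / 4)%:E + 2%:E * (4%:E * (eta / 16)%:E))%E; last first.
  by rewrite -!EFinM -EFinD; congr (_%:E); field.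
apply: leeD; apply: lee_wpmul2l => //; first exact: h.
apply: le_trans (translation_defect_le z mab) _; exact: lee_wpmul2l.
Qed.

(** Compactness makes the admissible translation uniform over [K]. *)
Lemma compact_open_translation (K U : set R) : compact K -> open U -> K `<=` U ->
  exists2 delta : R, 0 < delta & forall z x, `|z| < delta -> K x -> U (x + z).
Proof.
move=> cK oU KU.
have : \forall z \near (0 : R), K `<=` (fun x => U (x + z)).
  move: cK => /(@compact_near_coveringP R^o) cK; apply: (cK _ (nbhs (0 : R)) (fun z x => U (x + z))).
  move=> x Kx.
  have : nbhs (x + 0) U by rewrite addr0; apply: open_nbhs_nbhs; split => //; exact: KU.
  exact: (@add_continuous R^o (x, 0)).
move=> /nbhs_ballP[d /= d0 h]; exists d => // z x zd Kx.
by apply: (h z) => //; rewrite /ball/= sub0r normrN.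
Qed.

Lemma measurable_preimage_translation (z : R) (A : set R) : measurable A ->
  measurable [set x : R | A (x + z)].
Proof. by move=> mA; rewrite -[X in measurable X]setTI; exact: (measurable_translation z). Qed.

Lemma lebesgue_measure_preimage_translation (z : R) (A : set R) : measurable A ->
  mu [set x : R | A (x + z)] = mu A.
Proof. by move=> mA; rewrite -[RHS](lebesgue_measure_translation z). Qed.

Lemma translation_defect_indic (A : set R) (z : R) : measurable A ->
  translation_defect \1_A z = (mu [set x : R | A x /\ ~ A (x + z)%R] +
                               mu [set x : R | A x /\ ~ A (x - z)%R])%E.
Proof.
move=> mA.
pose B1 := A `&` ~` [set x : R | A (x + z)].
pose B2 := A `&` ~` [set x : R | A (x - z)].
have mB1 : measurable B1 by apply: measurableI => //; apply: measurableC; exact: measurable_preimage_translation.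
have mB2 : measurable B2 by apply: measurableI => //; apply: measurableC; exact: measurable_preimage_translation.
have mB2z := measurable_preimage_translation z mB2.
transitivity (mu B1 + mu B2)%E; last by [].
rewrite -(lebesgue_measure_preimage_translation z mB2).
have iE (B : set R) : measurable B -> mu B = (\int[mu]_x (\1_B x)%:E)%E.
  by move=> mB; rewrite integral_indic// setIT.
rewrite (iE _ mB1) (iE _ mB2z).
rewrite -ge0_integralD//; last 2 first.
- by apply/measurable_EFinP; exact: measurable_indic.
- by apply/measurable_EFinP; exact: measurable_indic.
apply: eq_integral => x _; rewrite -EFinD; congr (_%:E); rewrite !indicE.
have -> : (x \in B1) = (x \in A) && ((x : R) + z \notin A).
  by apply/idP/andP => [|[]]; rewrite notin_setE !inE.
have -> : (x \in [set x : R | B2 (x + z)]) = ((x : R) + z \in A) && (x \notin A).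
  by apply/idP/andP => [|[]]; rewrite notin_setE !inE /B2/= addrK.
by case: (x \in A); case: (_ \in A) => /=; ring.
Qed.

(** By regularity [A] lies between a compact set [K] and an open set [U] of almost
    the same measure. Under a small translation [K] stays in [U], so a point of [A]
    that leaves [A] is in [A \ K] or lands in [U \ A]. *)
Lemma vanishing_translation_defect_indic (A : set R) : measurable A -> (mu A < +oo)%E ->
  vanishing_translation_defect \1_A.
Proof.
move=> mA Afin eta eta0.
have e4 : 0 < eta / 4 by rewrite divr_gt0.
have [U [oU AU UA]] := lebesgue_regularity_outer mA Afin e4.
have [K [cK KA AK]] := lebesgue_regularity_inner mA Afin e4.
have [d d0 KUz] := compact_open_translation cK oU (subset_trans KA AU).
have mU : measurable U by exact: open_measurable.
have mK : measurable K by exact: compact_measurable.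
have mUA : measurable (U `\` A) by exact: measurableD.
have mUAz z := measurable_preimage_translation z mUA.
have H z : `|z| < d -> (mu [set x : R | A x /\ ~ A (x + z)%R] <= (eta / 4 + eta / 4)%:E)%E.
  move=> zd; apply: (@le_trans _ _ (mu (A `\` K `|` [set x : R | (U `\` A) (x + z)%R]))%E).
    apply: le_measure; rewrite ?inE.
    - apply: measurableI => //; apply: measurableC; exact: measurable_preimage_translation.
    - by apply: measurableU; [exact: measurableD|exact: mUAz].
    - move=> x /= [Ax Axz]; have [Kx|Kx] := pselect (K x); last by left.
      by right; split => //; exact: KUz.
  apply: (@le_trans _ _ (mu (A `\` K) + mu [set x : R | (U `\` A) (x + z)%R])%E).
    by apply: measureU2; [exact: measurableD|exact: mUAz].
  rewrite lebesgue_measure_preimage_translation//.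
  by rewrite EFinD; apply: leeD; exact: ltW.
exists d => // z zd; rewrite translation_defect_indic//.
rewrite (_ : eta = (eta / 4 + eta / 4) + (eta / 4 + eta / 4)); last by field.
by rewrite EFinD; apply: leeD; [exact: H|apply: H; rewrite normrN].
Qed.

End translation_continuity.

Section square_integrable_translation.
Context {R : realType}.
Local Notation mu := (@lebesgue_measure R).
Import HBNNSimple.

(** A simple function is a finite combination of indicators of its fibres; the
    fibres over nonzero values have finite measure by square integrability. *)
Lemma vanishing_translation_defect_nnsfun (f : {nnsfun R >-> R}) :
  (\int[mu]_x (f x ^+ 2)%:E < +oo)%E -> vanishing_translation_defect f.
Proof.
move=> ff.
have mf : measurable_fun setT f by [].
have mB y : measurable (f @^-1` [set y]) by rewrite -[X in measurable X]setTI; exact: mf.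
have m1 y : measurable_fun setT (\1_(f @^-1` [set y]) : R -> R) by exact: measurable_indic.
have vB y : vanishing_translation_defect (fun x => y * \1_(f @^-1` [set y]) x).
  have [->|y0] := eqVneq y 0.
    rewrite (_ : (fun _ => _) = (fun=> 0)); first exact: vanishing_translation_defect0.
    by apply/funext => x; rewrite mul0r.
  apply: vanishing_translation_defectZ; first exact: measurable_indic.
  apply: vanishing_translation_defect_indic => //.
  rewrite -[X in mu X]setIT -integral_indic//; last exact: (mB y).
  apply: (@le_lt_trans _ _ ((y ^- 2)%:E * \int[mu]_x (f x ^+ 2)%:E)%E).
    rewrite -ge0_integralZl//; last 3 first.
    - by apply/measurable_EFinP; exact: measurable_funX.
    - by move=> x _; rewrite lee_fin sqr_ge0.
    - by rewrite lee_fin invr_ge0 sqr_ge0.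
    apply: ge0_le_integral => //.
    - by apply/measurable_EFinP; exact: (m1 y).
    - by apply: measurable_funeM; apply/measurable_EFinP; exact: measurable_funX.
    - move=> x _; rewrite -EFinM lee_fin indicE.
      case: (boolP (x \in _)) => [|_]; last by rewrite mulr_ge0 ?invr_ge0 ?sqr_ge0.
      by rewrite inE/= => ->; rewrite mulVf// expf_neq0.
  by rewrite lte_mul_pinfty// lee_fin invr_ge0 sqr_ge0.
have vs (s : seq R) : vanishing_translation_defect (fun x => \sum_(y <- s) y * \1_(f @^-1` [set y]) x) /\
    measurable_fun setT (fun x => \sum_(y <- s) y * \1_(f @^-1` [set y]) x).
  elim: s => [|w s [IHv IHm]].
    under eq_fun do rewrite big_nil.
    by split; [exact: vanishing_translation_defect0|exact: measurable_cst].
  under eq_fun do rewrite big_cons.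
  have mw : measurable_fun setT (fun x => w * \1_(f @^-1` [set w]) x).
    by apply: measurable_funM => //; exact: (m1 w).
  by split; [exact: (vanishing_translation_defectD mw IHm (vB w) IHv)|exact: measurable_funD].
rewrite (_ : (f : R -> R) = fun x => \sum_(y <- finmap.enum_fset (fset_set (range f))) y * \1_(f @^-1` [set y]) x).
  exact: (vs _).1.
by apply/funext => x; rewrite {1}(fimfunE f) fsbig_finite.
Qed.

(** Approximation from below by simple functions; dominated convergence, with
    [a^2] as the bound, makes the approximation hold in the mean square. *)
Lemma vanishing_translation_defect_ge0 (a : R -> R) : measurable_fun setT a ->
  (forall x, 0 <= a x) -> (\int[mu]_x (a x ^+ 2)%:E < +oo)%E ->
  vanishing_translation_defect a.
Proof.
move=> ma a0 afin; apply: vanishing_translation_defect_closed => // eta eta0.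
have mEa : measurable_fun setT (EFin \o a) by exact/measurable_EFinP.
have Ea0 x : [set: R] x -> (0 <= (EFin \o a) x)%E by move=> _; rewrite lee_fin.
pose f := nnsfun_approx measurableT mEa.
have f_a x : f n x @[n --> \oo] --> a x.
  by have /fine_cvg := cvg_nnsfun_approx measurableT mEa Ea0 (I : [set: R] x).
have fle n x : f n x <= a x.
  have nd : nondecreasing_seq (f ^~ x) by move=> i j ij; exact/lefP/nd_nnsfun_approx.
  by rewrite -(cvg_lim (@Rhausdorff R) (f_a x)); apply: nondecreasing_cvgn_le => //; apply/cvg_ex; exists (a x).
have mfn n : measurable_fun setT (f n : R -> R) by exact: measurable_funPT.
have ia2 : mu.-integrable setT (fun x => (a x ^+ 2)%:E).
  apply/integrableP; split; first by apply/measurable_EFinP; exact: measurable_funX.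
  by under eq_integral do rewrite gee0_abs ?lee_fin ?sqr_ge0//.
have /(_ _)[] := @dominated_convergence _ _ _ mu setT measurableT
   (fun n x => ((a x - f n x) ^+ 2)%:E) (cst 0)%E (fun x => (a x ^+ 2)%:E).
- by move=> n; apply/measurable_EFinP; apply: measurable_funX; exact: (measurable_funB ma (mfn n)).
- exact: measurable_cst.
- apply: aeW => x _ /=; apply/cvg_EFin.
    exact: nearW.
  rewrite (_ : 0 = (a x - a x) ^+ 2); last by rewrite subrr expr0n.
  rewrite expr2; under eq_cvg do rewrite /= expr2.
  by apply: cvgM; (apply: cvgB; [exact: cvg_cst|exact: f_a]).
- exact: ia2.
- apply: aeW => x n _; rewrite gee0_abs ?lee_fin ?sqr_ge0// ler_sqr ?nnegrE ?subr_ge0//.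
  by rewrite gerBl fun_ge0.
move=> _ _; rewrite integral0 => /= fcvg.
have [n hn] : exists n, (\int[mu]_x ((a x - f n x) ^+ 2)%:E <= eta%:E)%E.
  have /fine_cvgP[finf /cvgrPdist_lt/(_ _ eta0) ltf] := fcvg.
  near \oo => n; exists n; rewrite -[leLHS]fineK; last by near: n.
  by rewrite lee_fin (le_trans (ler_norm _))// ltW// -[X in `|X|]opprK normrN -sub0r; near: n.
exists (f n); split => //; apply: vanishing_translation_defect_nnsfun.
apply: le_lt_trans afin; apply: ge0_le_integral => //.
- by move=> x _; rewrite lee_fin sqr_ge0.
- by apply/measurable_EFinP; exact: (measurable_funX 2 (mfn n)).
- by apply/measurable_EFinP; exact: measurable_funX.
- by move=> x _; rewrite lee_fin ler_sqr ?nnegrE// fun_ge0.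
Unshelve. all: by end_near. Qed.

Lemma vanishing_translation_defect_L2 (a : R -> R) : measurable_fun setT a ->
  (\int[mu]_x (a x ^+ 2)%:E < +oo)%E -> vanishing_translation_defect a.
Proof.
move=> ma afin.
have mp : measurable_fun setT a^\+ by exact: measurable_funrpos.
have mn : measurable_fun setT a^\- by exact: measurable_funrneg.
have bound (b : R -> R) : measurable_fun setT b -> (forall x, 0 <= b x <= `|a x|) ->
    vanishing_translation_defect b.
  move=> mb ba; apply: vanishing_translation_defect_ge0 => //.
    by move=> x; case/andP: (ba x).
  apply: le_lt_trans afin; apply: ge0_le_integral => //.
  - by move=> x _; rewrite lee_fin sqr_ge0.
  - by apply/measurable_EFinP; exact: measurable_funX.
  - by apply/measurable_EFinP; exact: measurable_funX.
  - move=> x _; rewrite lee_fin -[leRHS]real_normK ?num_real// ler_sqr ?nnegrE//; last by case/andP: (ba x).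
    by case/andP: (ba x).
rewrite -[a]funrposBneg (_ : _ - _ = (fun x => a^\+ x + (-1) * a^\- x)); last by apply/funext => x /=; rewrite mulN1r.
apply: (vanishing_translation_defectD mp (measurable_funM _ mn)) => //.
  by apply: bound => // x; rewrite funrpos_ge0/= ge_max ler_norm normr_ge0.
apply: (vanishing_translation_defectZ (-1) mn); apply: bound => // x.
by rewrite funrneg_ge0/= ge_max -normrN ler_norm normr_ge0.
Qed.

End square_integrable_translation.

(** * Plancherel's identity on the line *)

Section approximate_identity.
Context {R : realType}.
Local Notation mu := (@lebesgue_measure R).

(** Away from the origin the kernel at height [e] is [O(e)] times an integrable
    function that does not depend on [e]. *)
Lemma poisson_tail (e delta z : R) : 0 < e -> 0 < delta -> delta <= `|z| ->
  poisson e z <= e * (1 + delta ^- 2) * poisson 1 z.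
Proof.
move=> e0 d0 dz.
have z2 : delta ^+ 2 <= z ^+ 2.
  by rewrite -[leRHS]real_normK ?num_real// ler_sqr ?nnegrE// ltW.
have d2 : 0 < delta ^+ 2 by rewrite exprn_gt0.
rewrite /poisson expr1n mul1r -[leRHS]mulrA ler_wpM2l ?(ltW e0)//.
rewrite ler_pdivlMr ?ltr_pwDl ?sqr_ge0// mulrC ler_pdivrMr ?poisson_den_gt0//.
apply: (@le_trans _ _ ((1 + delta ^- 2) * z ^+ 2)).
  rewrite mulrDl mul1r addrC lerD2l mulrC ler_pdivlMr// mul1r//.
rewrite ler_wpM2l ?lerDr ?sqr_ge0// addr_ge0// invr_ge0 ltW//.
Qed.

(** The kernel is an approximate identity: near the origin the defect is small and
    the kernel has mass [pi]; away from it the defect is bounded and the kernel is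
    small. *)
Lemma poisson_defect_cvg0 (a : R -> R) : measurable_fun setT a ->
  (\int[mu]_x (a x ^+ 2)%:E < +oo)%E -> forall eta : R, 0 < eta ->
  exists2 e1 : R, 0 < e1 & forall e, 0 < e < e1 ->
    (\int[mu]_z ((poisson e z)%:E * translation_defect a z) <= eta%:E)%E.
Proof.
move=> ma afin eta eta0.
have pi0 := @pi_gt0 R.
have e2 : 0 < eta / (2 * pi) by rewrite divr_gt0// mulr_gt0.
have [d d0 hd] := vanishing_translation_defect_L2 ma afin e2.
pose K := fine (4%:E * \int[mu]_x (a x ^+ 2)%:E)%E.
have a2ge0 : (0 <= \int[mu]_x (a x ^+ 2)%:E)%E.
  by apply: integral_ge0 => x _; rewrite lee_fin sqr_ge0.
have KE : (4%:E * \int[mu]_x (a x ^+ 2)%:E = K%:E)%E.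
  by rewrite /K fineK// fin_numM// ge0_fin_numE.
have K0 : 0 <= K by rewrite fine_ge0// mule_ge0.
pose L := (1 + d ^- 2) * (K + 1) * pi.
have d2p : 0 < 1 + d ^- 2 by rewrite ltr_pwDl// invr_ge0 sqr_ge0.
have K1 : 0 < K + 1 by rewrite ltr_wpDl.
have L0 : 0 < L by rewrite !mulr_gt0.
exists (eta / (2 * L)); first by rewrite divr_gt0// mulr_gt0.
move=> e /andP[e0 eL].
have ek0 : 0 <= e * (1 + d ^- 2) * (K + 1) by rewrite ltW// !mulr_gt0.
have mP e' : 0 < e' -> measurable_fun setT (fun z => (poisson e' z)%:E).
  by move=> e'0; apply/measurable_EFinP; exact: measurable_poisson.
have mD : measurable_fun setT (translation_defect a).
  apply: (@measurable_integral_param _ _ _ _ _ mu (fun p : R * R => ((a p.2 - a (p.2 + p.1)) ^+ 2)%:E)).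
  apply/measurable_EFinP; apply: measurable_funX; apply: measurable_funB; first exact: measurableT_comp.
  by apply: (measurableT_comp ma); exact: measurable_funD.
apply: (@le_trans _ _ (\int[mu]_z ((eta / (2 * pi))%:E * (poisson e z)%:E +
    (e * (1 + d ^- 2) * (K + 1))%:E * (poisson 1 z)%:E))%E).
  apply: ge0_le_integral => //.
  - by move=> z _; rewrite mule_ge0 ?translation_defect_ge0 ?lee_fin ?poisson_ge0.
  - by apply: emeasurable_funM => //; exact: mP.
  - by apply: emeasurable_funD; apply: measurable_funeM; exact: mP.
  move=> z _; have [zd|zd] := ltP `|z| d.
    apply: (@le_trans _ _ ((eta / (2 * pi))%:E * (poisson e z)%:E)%E).
      by rewrite muleC lee_wpmul2r ?lee_fin ?poisson_ge0// hd.
    by rewrite leeDl// -EFinM lee_fin mulr_ge0 ?poisson_ge0.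
  apply: (@le_trans _ _ ((e * (1 + d ^- 2) * (K + 1))%:E * (poisson 1 z)%:E)%E); last first.
    by rewrite leeDr// -EFinM lee_fin mulr_ge0 ?poisson_ge0// ltW.
  apply: (@le_trans _ _ ((poisson e z)%:E * K%:E)%E).
    by rewrite lee_wpmul2l ?lee_fin ?poisson_ge0// -KE translation_defect_le.
  rewrite -!EFinM lee_fin [leRHS]mulrAC ler_pM ?poisson_ge0 ?poisson_tail//.
  by rewrite lerDl.
rewrite ge0_integralD//; last 4 first.
- by move=> z _; rewrite -EFinM lee_fin mulr_ge0 ?poisson_ge0// ltW.
- by apply: measurable_funeM; exact: mP.
- by move=> z _; rewrite -EFinM lee_fin mulr_ge0 ?poisson_ge0.
- by apply: measurable_funeM; exact: mP.
have IP c e' : 0 <= c -> 0 < e' -> (\int[mu]_z (c%:E * (poisson e' z)%:E) = (c * pi)%:E)%E.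
  move=> c0 e'0; rewrite ge0_integralZl ?integral_poisson ?lee_fin//; first exact: mP.
  by move=> z _; rewrite lee_fin poisson_ge0.
rewrite !IP ?(ltW e2)// -EFinD lee_fin.
have -> : eta / (2 * pi) * pi = eta / 2 by rewrite invfM mulrA divfK// gt_eqF.
have -> : e * (1 + d ^- 2) * (K + 1) * pi = e * L by rewrite /L; ring.
move: eL; rewrite ltr_pdivlMr ?mulr_gt0//; lra.
Qed.

End approximate_identity.

Lemma ge0_cvge0 {R : realType} (u : (\bar R)^nat) : (forall n, 0 <= u n)%E ->
  (forall eta : R, 0 < eta -> \forall n \near \oo, (u n <= eta%:E)%E) ->
  u n @[n --> \oo] --> 0%E.
Proof.
move=> u0 H; apply/fine_cvgP; split.
  by apply: filterS (H 1 ltr01) => n un; rewrite ge0_fin_numE// (le_lt_trans un)// ltry.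
apply/cvgrPdist_le => eta eta0; apply: filterS (H eta eta0) => n un.
have fn : u n \is a fin_num by rewrite ge0_fin_numE// (le_lt_trans un)// ltry.
by rewrite sub0r normrN ger0_norm ?fine_ge0//= -lee_fin fineK.
Qed.

Section plancherel_line.
Context {R : realType}.
Local Notation mu := (@lebesgue_measure R).

Lemma ge0_integral_even (f : R -> \bar R) : measurable_fun setT f ->
  (forall x, 0 <= f x)%E -> (forall x, f (- x) = f x) ->
  (\int[mu]_x f x = 2%:E * \int[mu]_(x in `[0%R, +oo[) f x)%E.
Proof.
move=> mf f0 fN.
rewrite -(setUv `[0%R, +oo[%classic) ge0_integral_setU//=; last 3 first.
- exact: measurableC.
- by rewrite setUv.
- exact/disj_setPCl.
rewrite setCitvr integral_itv_bndo_bndc; last exact: measurable_funTS.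
rewrite mule_natl mule2n; congr (_ + _)%E.
by rewrite ge0_integration_by_substitution0//; apply: eq_integral => x _; rewrite fN.
Qed.

Lemma abel_cvg (x : R) : abel n.+1%:R^-1 x @[n --> \oo] --> (\1_`[0%R, +oo[ x : R).
Proof.
rewrite indicE; have [x0|x0] := boolP (x \in _); last first.
  rewrite (_ : (fun n : nat => _) = (fun=> 0)); first exact: cvg_cst.
  by apply/funext => n; rewrite /abel patchE (negbTE x0).
rewrite (_ : (fun n : nat => _) = (fun n : nat => expR (- n.+1%:R^-1 * x))); last first.
  by apply/funext => n; rewrite /abel patchE x0.
have h : - n.+1%:R^-1 * x @[n --> \oo] --> (0 : R).
  rewrite -[X in _ --> X](mul0r x); apply: cvgM; last exact: cvg_cst.
  by rewrite -oppr0; apply: cvgN; exact: cvg_harmonic.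
by rewrite /= -[X in _ --> X]expR0; exact: (cvg_comp _ _ h (@continuous_expR R 0)).
Qed.

Lemma nondecreasing_abel (x : R) : {homo (fun n : nat => abel n.+1%:R^-1 x) : m n / (m <= n)%N >-> m <= n}.
Proof.
move=> m n mn; rewrite /abel !patchE; case: ifPn => //; rewrite inE/= in_itv/= andbT => x0.
by rewrite ler_expR !mulNr lerN2 ler_wpM2r// lef_pV2 ?posrE ?ltr0n// ler_nat ltnS.
Qed.

(** The weighted identity of [integral_abel_sqr_transform] in the limit where the
    weight becomes 1: monotone convergence on the transform side, vanishing of the
    averaged translation defect on the other side. *)
Theorem real_plancherel_line (a : R -> R) :
  mu.-integrable setT (EFin \o a) -> mu.-integrable setT (EFin \o (fun x => a x ^+ 2)) ->
  (\int[mu]_xi (cosine_transform a xi ^+ 2 + sine_transform a xi ^+ 2)%:E =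
   (2 * pi)%:E * \int[mu]_x (a x ^+ 2)%:E)%E.
Proof.
move=> ia ia2.
have ma : measurable_fun setT a by apply/measurable_EFinP; exact: measurable_int ia.
pose G xi := cosine_transform a xi ^+ 2 + sine_transform a xi ^+ 2.
have G0 xi : 0 <= G xi by rewrite addr_ge0 ?sqr_ge0.
have mG : measurable_fun setT G.
  apply: measurable_funD; apply: measurable_funX.
    exact: measurable_cosine_transform.
  exact: measurable_sine_transform.
have GN xi : G (- xi) = G xi.
  rewrite /G /cosine_transform /sine_transform; congr (_ ^+ 2 + _).
    by apply: eq_Rintegral => x _; rewrite mulrN cosN.
  under eq_Rintegral do rewrite mulrN sinN mulrN -mulN1r.
  rewrite RintegralZl ?mulN1r ?sqrrN//.
  apply: (@integrable_mul_bounded _ _ _ _ _ _ 1) => //; last by move=> x; exact: sin_max.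
  by apply: (measurableT_comp measurable_sin); exact: measurable_funM.
have mEG : measurable_fun setT (EFin \o G) by exact/measurable_EFinP.
have EG0 xi : (0 <= (EFin \o G) xi)%E by rewrite lee_fin.
have EGN xi : (EFin \o G) (- xi) = (EFin \o G) xi by rewrite /= GN.
rewrite (ge0_integral_even mEG EG0 EGN).
set I2 := \int[mu]_x (a x ^+ 2).
have I2E : (\int[mu]_x (a x ^+ 2)%:E = I2%:E)%E.
  by rewrite /I2 /Rintegral fineK//; exact: integrable_fin_num ia2.
pose Q n := (\int[mu]_xi (abel n.+1%:R^-1 xi * G xi)%:E)%E.
have cvg1 : Q n @[n --> \oo] --> (\int[mu]_(xi in `[0%R, +oo[) (G xi)%:E)%E.
  rewrite (_ : \int[mu]_(xi in _) _ = \int[mu]_xi limn (fun n => (abel n.+1%:R^-1 xi * G xi)%:E))%E.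
    apply: cvg_monotone_convergence => //.
    - move=> n; apply/measurable_EFinP; apply: measurable_funM => //; exact: measurable_abel.
    - by move=> n xi _; rewrite lee_fin mulr_ge0 ?abel_ge0.
    - by move=> xi _ m n mn; rewrite lee_fin ler_wpM2r// nondecreasing_abel.
  rewrite integral_mkcond; apply: eq_integral => xi _; apply/esym/cvg_lim => //.
  have -> : ((EFin \o G) \_ `[0%R, +oo[) xi = (\1_`[0%R, +oo[ xi * G xi)%:E.
    by rewrite patchE indicE; case: ifP => _; rewrite ?mul1r ?mul0r.
  by apply/cvg_EFin; [exact: nearW|apply: cvgM; [exact: abel_cvg|exact: cvg_cst]].
have QE n : Q n = ((I2 * pi)%:E - 2^-1%:E * \int[mu]_z ((poisson n.+1%:R^-1 z)%:E * translation_defect a z))%E.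
  by rewrite /Q integral_abel_sqr_transform// poisson_quadratic_formE.
have cvg2 : Q n @[n --> \oo] --> (I2 * pi)%:E.
  rewrite -[X in _ --> X]sube0 (_ : Q = fun n => ((I2 * pi)%:E -
    2^-1%:E * \int[mu]_z ((poisson n.+1%:R^-1 z)%:E * translation_defect a z))%E); last exact/funext.
  apply: cvgeB => //; first exact: cvg_cst.
  rewrite -[X in _ --> X](mule0 2^-1%:E); apply: cvgeZl => //.
  apply: ge0_cvge0 => [n|eta eta0].
    by apply: integral_ge0 => z _; rewrite mule_ge0 ?translation_defect_ge0// lee_fin poisson_ge0.
  have afin : (\int[mu]_x (a x ^+ 2)%:E < +oo)%E by rewrite I2E ltry.
  have [e1 e10 he] := poisson_defect_cvg0 ma afin eta0.
  apply: filterS (near_infty_natSinv_lt (PosNum e10)) => n /= ne.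
  by apply: he; rewrite invr_gt0 ltr0n.
have -> := cvg_unique (@ereal_hausdorff R) cvg1 cvg2; by rewrite I2E -!EFinM; congr (_%:E); ring.
Qed.

End plancherel_line.

(** Real and imaginary parts of the integral of [exp(- i th(x)) (a(x) + i b(x))].
    The phase is arbitrary so that the line, products and tuples share one
    notion. *)
Section fourier_parts.
Context d (T : measurableType d) {R : realType} (m : {measure set T -> \bar R}).

Definition fourier_re (th a b : T -> R) : R :=
  \int[m]_x (a x * cos (th x) + b x * sin (th x)).
Definition fourier_im (th a b : T -> R) : R :=
  \int[m]_x (b x * cos (th x) - a x * sin (th x)).

End fourier_parts.

Section plancherel_line_complex.
Context {R : realType}.
Local Notation mu := (@lebesgue_measure R).
Variables a b : R -> R.
Hypotheses (ia : mu.-integrable setT (EFin \o a)) (ia2 : mu.-integrable setT (EFin \o (fun x => a x ^+ 2))).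
Hypotheses (ib : mu.-integrable setT (EFin \o b)) (ib2 : mu.-integrable setT (EFin \o (fun x => b x ^+ 2))).

Let phase (xi x : R) : R := x * xi.

Let integrable_trig (f : R -> R) (xi : R) : mu.-integrable setT (EFin \o f) ->
  mu.-integrable setT (EFin \o (fun x => f x * cos (x * xi))) /\
  mu.-integrable setT (EFin \o (fun x => f x * sin (x * xi))).
Proof.
move=> if1; split; apply: (@integrable_mul_bounded _ _ _ _ _ _ 1) => //.
- by apply: (measurableT_comp measurable_cos); exact: measurable_funM.
- by move=> x; exact: cos_max.
- by apply: (measurableT_comp measurable_sin); exact: measurable_funM.
- by move=> x; exact: sin_max.
Qed.

Lemma fourier_reE (xi : R) :
  fourier_re mu (phase xi) a b = cosine_transform a xi + sine_transform b xi.
Proof.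
rewrite /fourier_re /cosine_transform /sine_transform -RintegralD//.
- exact: (integrable_trig xi ia).1.
- exact: (integrable_trig xi ib).2.
Qed.

Lemma fourier_imE (xi : R) :
  fourier_im mu (phase xi) a b = cosine_transform b xi - sine_transform a xi.
Proof.
rewrite /fourier_im /cosine_transform /sine_transform -RintegralB//.
- exact: (integrable_trig xi ib).1.
- exact: (integrable_trig xi ia).2.
Qed.

(** The squared modulus of the transform of [a + i b] contains cross terms of [a]
    and [b]; they are odd in the frequency, so they cancel in the sum of the values
    at [xi] and [- xi]. *)
Theorem plancherel_line :
  (\int[mu]_xi (fourier_re mu (fun x : R => x * xi)%R a b ^+ 2 + fourier_im mu (fun x : R => x * xi)%R a b ^+ 2)%:E =
   (2 * pi)%:E * \int[mu]_x (a x ^+ 2 + b x ^+ 2)%:E)%E.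
Proof.
(* Reflecting the frequency leaves the integral of [G] unchanged, so twice that
   integral is the integral of the sum of the values at [xi] and [- xi]. *)
pose G xi := fourier_re mu (phase xi) a b ^+ 2 + fourier_im mu (phase xi) a b ^+ 2.
pose Ga xi := cosine_transform a xi ^+ 2 + sine_transform a xi ^+ 2.
pose Gb xi := cosine_transform b xi ^+ 2 + sine_transform b xi ^+ 2.
have mCS (f : R -> R) : mu.-integrable setT (EFin \o f) ->
    measurable_fun setT (cosine_transform f) /\ measurable_fun setT (sine_transform f).
  by move=> if1; split; [exact: measurable_cosine_transform|exact: measurable_sine_transform].
have [mCa mSa] := mCS _ ia; have [mCb mSb] := mCS _ ib.
have mGa : measurable_fun setT (EFin \o Ga).
  by apply/measurable_EFinP; apply: measurable_funD; apply: measurable_funX.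
have mGb : measurable_fun setT (EFin \o Gb).
  by apply/measurable_EFinP; apply: measurable_funD; apply: measurable_funX.
have mG : measurable_fun setT (EFin \o G).
  apply/measurable_EFinP; rewrite /G; under eq_fun do rewrite fourier_reE fourier_imE.
  by apply: measurable_funD; apply: measurable_funX; [exact: measurable_funD|exact: measurable_funB].
have G0 xi : (0 <= (EFin \o G) xi)%E by rewrite lee_fin addr_ge0 ?sqr_ge0.
have Ga0 xi : (0 <= (EFin \o Ga) xi)%E by rewrite lee_fin addr_ge0 ?sqr_ge0.
have Gb0 xi : (0 <= (EFin \o Gb) xi)%E by rewrite lee_fin addr_ge0 ?sqr_ge0.
have mGN : measurable_fun setT (fun xi : R => (EFin \o G) (- xi)).
  by apply: (measurableT_comp mG); exact: oppr_measurable.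
have CSN (f : R -> R) xi : mu.-integrable setT (EFin \o f) ->
    cosine_transform f (- xi) = cosine_transform f xi /\ sine_transform f (- xi) = - sine_transform f xi.
  move=> if1; split; first by apply: eq_Rintegral => x _; rewrite mulrN cosN.
  rewrite /sine_transform; under eq_Rintegral do rewrite mulrN sinN mulrN -mulN1r.
  by rewrite RintegralZl ?mulN1r//; exact: (integrable_trig xi if1).2.
have GE xi : ((EFin \o G) xi + (EFin \o G) (- xi)%R = 2%:E * ((EFin \o Ga) xi + (EFin \o Gb) xi))%E.
  rewrite /= -!EFinD -EFinM /G /Ga /Gb !fourier_reE !fourier_imE.
  have [-> ->] := CSN a xi ia; have [-> ->] := CSN b xi ib.
  by congr (_%:E); ring.
have I2E (f : R -> R) : mu.-integrable setT (EFin \o (fun x => f x ^+ 2)) ->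
    (\int[mu]_x (f x ^+ 2)%:E = (\int[mu]_x (f x ^+ 2))%:E)%E.
  by move=> if2; rewrite /Rintegral fineK//; exact: integrable_fin_num if2.
have : (\int[mu]_xi (EFin \o G) xi + \int[mu]_xi (EFin \o G) xi =
   2%:E * ((2 * pi)%:E * \int[mu]_x (a x ^+ 2)%:E + (2 * pi)%:E * \int[mu]_x (b x ^+ 2)%:E))%E.
  transitivity (\int[mu]_xi ((EFin \o G) xi + (EFin \o G) (- (xi : R))%R))%E.
    apply/esym; rewrite (@ge0_integralD _ _ _ mu _ measurableT _ _ (fun x _ => G0 x) mG (fun x _ => G0 (- x)) mGN).
    by congr (_ + _)%E; exact: (ge0_integral_reflection mG G0).
  transitivity (\int[mu]_xi (2%:E * ((EFin \o Ga) xi + (EFin \o Gb) xi)))%E.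
    by apply: eq_integral => xi _; rewrite GE.
  have Gab0 xi : (0 <= (EFin \o Ga) xi + (EFin \o Gb) xi)%E by rewrite adde_ge0.
  rewrite (@ge0_integralZl _ _ _ mu _ measurableT _ (emeasurable_funD mGa mGb) 2%:E (fun x _ => Gab0 x))//.
  rewrite (@ge0_integralD _ _ _ mu _ measurableT _ _ (fun x _ => Ga0 x) mGa (fun x _ => Gb0 x) mGb).
  by rewrite -!real_plancherel_line.
have -> : (\int[mu]_x (a x ^+ 2 + b x ^+ 2)%:E =
    \int[mu]_x (a x ^+ 2)%:E + \int[mu]_x (b x ^+ 2)%:E)%E.
  exact: (integralD measurableT ia2 ib2).
rewrite !I2E// -!EFinM => H.
rewrite -[LHS]/(\int[mu]_xi (EFin \o G) xi)%E.
case: (\int[mu]_xi (EFin \o G) xi)%E H => [r| |]//= [] H.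
by congr (_%:E); lra.
Qed.

End plancherel_line_complex.

(** * Plancherel's identity on products and on Euclidean space *)

Section plancherel_property.
Context d (T : measurableType d) {R : realType} (m : {measure set T -> \bar R}).

Definition in_L1_L2 (f : T -> R) : Prop :=
  m.-integrable setT (EFin \o f) /\ m.-integrable setT (EFin \o (fun x => f x ^+ 2)).

(** Plancherel's identity for the transform with phase [th] and constant [c]; the
    form is stable under products, with phases added and constants multiplied. *)
Definition plancherel_for (th : T -> T -> R) (c : R) : Prop :=
  forall a b, in_L1_L2 a -> in_L1_L2 b ->
  (\int[m]_xi (fourier_re m (th xi) a b ^+ 2 + fourier_im m (th xi) a b ^+ 2)%:E =
   c%:E * \int[m]_x (a x ^+ 2 + b x ^+ 2)%:E)%E.

Lemma in_L1_L2_measurable (f : T -> R) : in_L1_L2 f -> measurable_fun setT f.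
Proof. by move=> [if1 _]; apply/measurable_EFinP; exact: measurable_int if1. Qed.

Lemma integrable_fourier (th a b : T -> R) : measurable_fun setT th ->
  m.-integrable setT (EFin \o a) -> m.-integrable setT (EFin \o b) ->
  m.-integrable setT (EFin \o (fun x => a x * cos (th x) + b x * sin (th x))) /\
  m.-integrable setT (EFin \o (fun x => b x * cos (th x) - a x * sin (th x))).
Proof.
move=> mth ia ib.
have mc : measurable_fun setT (fun x => cos (th x)) by apply: (measurableT_comp measurable_cos).
have ms : measurable_fun setT (fun x => sin (th x)) by apply: (measurableT_comp measurable_sin).
have ic f (if1 : m.-integrable setT (EFin \o f)) :=
  integrable_mul_bounded if1 mc (fun x => cos_max (th x)).
have is_ f (if1 : m.-integrable setT (EFin \o f)) :=
  integrable_mul_bounded if1 ms (fun x => sin_max (th x)).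
split; first exact: (integrableD measurableT (ic _ ia) (is_ _ ib)).
exact: (integrableB measurableT (ic _ ib) (is_ _ ia)).
Qed.

End plancherel_property.

Section plancherel_product.
Context d1 d2 (T1 : measurableType d1) (T2 : measurableType d2) {R : realType}.
Context (m1 : {sigma_finite_measure set T1 -> \bar R})
        (m2 : {sigma_finite_measure set T2 -> \bar R}).
Variables (th1 : T1 -> T1 -> R) (th2 : T2 -> T2 -> R) (c1 c2 : R).
Hypotheses (mth1 : measurable_fun setT (fun p : T1 * T1 => th1 p.1 p.2))
           (mth2 : measurable_fun setT (fun p : T2 * T2 => th2 p.1 p.2)).
Hypotheses (P1 : plancherel_for m1 th1 c1) (P2 : plancherel_for m2 th2 c2).
Hypotheses (c10 : 0 <= c1) (c20 : 0 <= c2).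

Let th (xi x : T1 * T2) : R := th1 xi.1 x.1 + th2 xi.2 x.2.

Section functions.
Variables a b : T1 * T2 -> R.
Hypotheses (La : in_L1_L2 (m1 \x m2)%E a) (Lb : in_L1_L2 (m1 \x m2)%E b).

Let ma : measurable_fun setT a. Proof. exact: in_L1_L2_measurable La. Qed.
Let mb : measurable_fun setT b. Proof. exact: in_L1_L2_measurable Lb. Qed.

(* The partial transform in the second variable; [p] holds the first variable
   and the second frequency. *)
Let gR (p : T1 * T2) := fourier_re m2 (th2 p.2) (fun y => a (p.1, y)) (fun y => b (p.1, y)).
Let gI (p : T1 * T2) := fourier_im m2 (th2 p.2) (fun y => a (p.1, y)) (fun y => b (p.1, y)).

Let mth1x xi : measurable_fun setT (th1 xi).
Proof. exact: (measurableT_comp mth1 (pair1_measurable xi)). Qed.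

Let mth2x eta : measurable_fun setT (th2 eta).
Proof. exact: (measurableT_comp mth2 (pair1_measurable eta)). Qed.

Let mreorder (f : T1 * T2 -> R) : measurable_fun setT f ->
  measurable_fun setT (fun q : (T1 * T2) * T2 => f (q.1.1, q.2)).
Proof.
move=> mf.
have mr : measurable_fun setT (fun q : (T1 * T2) * T2 => (q.1.1, q.2)).
  by apply/measurable_fun_pairP; split; [exact: (measurableT_comp measurable_fst measurable_fst)|exact: measurable_snd].
exact: (measurableT_comp mf mr).
Qed.

Let mphase : measurable_fun setT (fun q : (T1 * T2) * T2 => th2 q.1.2 q.2).
Proof.
have mr : measurable_fun setT (fun q : (T1 * T2) * T2 => (q.1.2, q.2)).
  by apply/measurable_fun_pairP; split; [exact: (measurableT_comp measurable_snd measurable_fst)|exact: measurable_snd].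
exact: (measurableT_comp mth2 mr).
Qed.

Let mgR : measurable_fun setT gR.
Proof.
apply: (@measurable_Rintegral_param _ _ _ _ _ m2 (fun q : (T1 * T2) * T2 =>
  a (q.1.1, q.2) * cos (th2 q.1.2 q.2) + b (q.1.1, q.2) * sin (th2 q.1.2 q.2))).
apply: measurable_funD; apply: measurable_funM; try exact: mreorder.
  exact: (measurableT_comp measurable_cos mphase).
exact: (measurableT_comp measurable_sin mphase).
Qed.

Let mgI : measurable_fun setT gI.
Proof.
apply: (@measurable_Rintegral_param _ _ _ _ _ m2 (fun q : (T1 * T2) * T2 =>
  b (q.1.1, q.2) * cos (th2 q.1.2 q.2) - a (q.1.1, q.2) * sin (th2 q.1.2 q.2))).
apply: measurable_funB; apply: measurable_funM; try exact: mreorder.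
  exact: (measurableT_comp measurable_cos mphase).
exact: (measurableT_comp measurable_sin mphase).
Qed.

Let ae_slice : {ae m1, forall x,
  in_L1_L2 m2 (fun y => a (x, y)) /\ in_L1_L2 m2 (fun y => b (x, y))}.
Proof.
have [ia ia2] := La; have [ib ib2] := Lb.
apply: filterS2 (filterI (ae_integrable1 ia) (ae_integrable1 ib))
  (filterI (ae_integrable1 ia2) (ae_integrable1 ib2)).
by move=> x [? ?] [? ?].
Qed.

Let mths xi eta : measurable_fun setT (th (xi, eta)).
Proof.
apply: measurable_funD; first exact: (measurableT_comp (mth1x xi) measurable_fst).
exact: (measurableT_comp (mth2x eta) measurable_snd).
Qed.

Let gE x eta : in_L1_L2 m2 (fun y => a (x, y)) -> in_L1_L2 m2 (fun y => b (x, y)) ->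
  m2.-integrable setT (EFin \o (fun y => a (x, y) * cos (th2 eta y) + b (x, y) * sin (th2 eta y))) /\
  m2.-integrable setT (EFin \o (fun y => b (x, y) * cos (th2 eta y) - a (x, y) * sin (th2 eta y))).
Proof. by move=> [iax _] [ibx _]; exact: (integrable_fourier (mth2x eta) iax ibx). Qed.

Let mslice (g : T1 * T2 -> R) eta : measurable_fun setT g -> measurable_fun setT (fun x => g (x, eta)).
Proof. by move=> mg; exact: (measurableT_comp mg (pair2_measurable eta)). Qed.

Let mcos1 xi : measurable_fun setT (fun x => cos (th1 xi x)).
Proof. exact: (measurableT_comp measurable_cos (mth1x xi)). Qed.

Let msin1 xi : measurable_fun setT (fun x => sin (th1 xi x)).
Proof. exact: (measurableT_comp measurable_sin (mth1x xi)). Qed.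

(* The full transform is the transform in the first variable of the partial
   one, because the phases add. *)
Let fourier_re_slice xi eta : fourier_re (m1 \x m2)%E (th (xi, eta)) a b =
  fourier_re m1 (th1 xi) (fun x => gR (x, eta)) (fun x => gI (x, eta)).
Proof.
have [ih _] := integrable_fourier (mths xi eta) La.1 Lb.1.
congr fine; rewrite -(integral12_prod_meas1 ih).
apply: ae_eq_integral => //.
- exact: (measurable_fubini_F ih).
- apply/measurable_EFinP; apply: measurable_funD; apply: measurable_funM;
    [exact: mslice|exact: mcos1|exact: mslice|exact: msin1].
apply: filterS ae_slice => x [Lax Lbx] _.
have [iR iI] := gE eta Lax Lbx.
have iRc := integrableZr measurableT (cos (th1 xi x)) iR.
have iIc := integrableZr measurableT (sin (th1 xi x)) iI.
rewrite /fubini_F /gR /gI /fourier_re /fourier_im /= -!RintegralZr// -RintegralD//.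
rewrite /Rintegral fineK; last by apply: integrable_fin_num => //; exact: (integrableD measurableT iRc iIc).
by apply: eq_integral => y _; congr (_%:E); rewrite /th/= cosD sinD; ring.
Qed.

Let fourier_im_slice xi eta : fourier_im (m1 \x m2)%E (th (xi, eta)) a b =
  fourier_im m1 (th1 xi) (fun x => gR (x, eta)) (fun x => gI (x, eta)).
Proof.
have [_ ih] := integrable_fourier (mths xi eta) La.1 Lb.1.
congr fine; rewrite -(integral12_prod_meas1 ih).
apply: ae_eq_integral => //.
- exact: (measurable_fubini_F ih).
- apply/measurable_EFinP; apply: measurable_funB; apply: measurable_funM;
    [exact: mslice|exact: mcos1|exact: mslice|exact: msin1].
apply: filterS ae_slice => x [Lax Lbx] _.
have [iR iI] := gE eta Lax Lbx.
have iRc := integrableZr measurableT (sin (th1 xi x)) iR.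
have iIc := integrableZr measurableT (cos (th1 xi x)) iI.
rewrite /fubini_F /gR /gI /fourier_re /fourier_im /= -!RintegralZr// -RintegralB//.
rewrite /Rintegral fineK; last by apply: integrable_fin_num => //; exact: (integrableB measurableT iIc iRc).
by apply: eq_integral => y _; congr (_%:E); rewrite /th/= cosD sinD; ring.
Qed.

(* With only the second phase, the integrand on the product is integrable;
   Fubini's theorem makes its partial integral integrable. *)
Let L1gR eta : m1.-integrable setT (EFin \o (fun x => gR (x, eta))).
Proof.
have mth2p : measurable_fun setT (fun p : T1 * T2 => th2 eta p.2).
  exact: (measurableT_comp (mth2x eta) measurable_snd).
have [ih _] := integrable_fourier mth2p La.1 Lb.1.
apply: (le_integrable _ _ _ (integrable_fubini_F ih)) => //.
  by apply/measurable_EFinP; exact: mslice.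
move=> x _ /=; rewrite /gR /fourier_re /Rintegral /fubini_F /=.
by case: (\int[m2]_y _)%E => [r||] //=; rewrite normr0 leey.
Qed.

Let L1gI eta : m1.-integrable setT (EFin \o (fun x => gI (x, eta))).
Proof.
have mth2p : measurable_fun setT (fun p : T1 * T2 => th2 eta p.2).
  exact: (measurableT_comp (mth2x eta) measurable_snd).
have [_ ih] := integrable_fourier mth2p La.1 Lb.1.
apply: (le_integrable _ _ _ (integrable_fubini_F ih)) => //.
  by apply/measurable_EFinP; exact: mslice.
move=> x _ /=; rewrite /gI /fourier_im /Rintegral /fubini_F /=.
by case: (\int[m2]_y _)%E => [r||] //=; rewrite normr0 leey.
Qed.

Let E (p : T1 * T2) : \bar R := (gR p ^+ 2 + gI p ^+ 2)%:E.

Let mE : measurable_fun setT E.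
Proof. by apply/measurable_EFinP; apply: measurable_funD; apply: measurable_funX. Qed.

Let E0 p : (0 <= E p)%E.
Proof. by rewrite lee_fin addr_ge0 ?sqr_ge0. Qed.

Let u2 (p : T1 * T2) : \bar R := (a p ^+ 2 + b p ^+ 2)%:E.

Let mu2 : measurable_fun setT u2.
Proof. by apply/measurable_EFinP; apply: measurable_funD; apply: measurable_funX. Qed.

Let u20 p : (0 <= u2 p)%E.
Proof. by rewrite lee_fin addr_ge0 ?sqr_ge0. Qed.

Let mE1 : measurable_fun setT (fun x => \int[m2]_eta E (x, eta))%E.
Proof. exact: (measurable_fun_fubini_tonelli_F E mE E0). Qed.

Let mE2 : measurable_fun setT (fun eta => \int[m1]_x E (x, eta))%E.
Proof. exact: (measurable_fun_fubini_tonelli_G E mE E0). Qed.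

Let mu21 : measurable_fun setT (fun x => \int[m2]_y u2 (x, y))%E.
Proof. exact: (measurable_fun_fubini_tonelli_F u2 mu2 u20). Qed.

(* Plancherel's identity in the second variable, on almost every slice. *)
Let iterated_energy : (\int[m1]_x \int[m2]_eta E (x, eta) = c2%:E * \int[m1 \x m2]_p u2 p)%E.
Proof.
rewrite (fubini_tonelli1 u2 mu2 u20) -ge0_integralZl//; last by move=> x _; exact: integral_ge0.
apply: ge0_ae_eq_integral => //.
- exact: measurable_funeM.
- by move=> x _; exact: integral_ge0.
- by move=> x _; rewrite mule_ge0 ?lee_fin//; exact: integral_ge0.
by apply: filterS ae_slice => x [Lax Lbx] _; exact: (P2 Lax Lbx).
Qed.

(* Square integrability of the partial transform in the first variable comes
   from the finiteness of its total energy. *)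
Let ae_L1_L2 : {ae m2, forall eta,
  in_L1_L2 m1 (fun x => gR (x, eta)) /\ in_L1_L2 m1 (fun x => gI (x, eta))}.
Proof.
have iE : (m1 \x m2)%E.-integrable setT E.
  apply/integrable12ltyP => //.
  under eq_integral do under eq_integral do rewrite gee0_abs//.
  rewrite iterated_energy lte_mul_pinfty ?lee_fin//.
  exact: (integrable_lty measurableT (integrableD measurableT La.2 Lb.2)).
apply: filterS (ae_integrable2 iE) => eta iEeta; split; split => //.
- apply: (le_integrable _ _ _ iEeta) => //.
    by apply/measurable_EFinP; apply: measurable_funX; exact: mslice.
  by move=> x _; rewrite lee_fin !ger0_norm ?addr_ge0 ?sqr_ge0// lerDl sqr_ge0.
- apply: (le_integrable _ _ _ iEeta) => //.
    by apply/measurable_EFinP; apply: measurable_funX; exact: mslice.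
  by move=> x _; rewrite lee_fin !ger0_norm ?addr_ge0 ?sqr_ge0// lerDr sqr_ge0.
Qed.

(** Plancherel's identity is applied in the second variable for almost every value
    of the first, then in the first variable for almost every second frequency. *)
Lemma plancherel_product_aux :
  (\int[m1 \x m2]_xi (fourier_re (m1 \x m2)%E (th xi) a b ^+ 2 +
                      fourier_im (m1 \x m2)%E (th xi) a b ^+ 2)%:E =
   (c1 * c2)%:E * \int[m1 \x m2]_x (a x ^+ 2 + b x ^+ 2)%:E)%E.
Proof.
pose uhat2 (xi : T1 * T2) : \bar R := (fourier_re (m1 \x m2)%E (th xi) a b ^+ 2 +
                      fourier_im (m1 \x m2)%E (th xi) a b ^+ 2)%:E.
have muhat2 : measurable_fun setT uhat2.
  have mr (g : T1 * T2 -> R) : measurable_fun setT g ->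
      measurable_fun setT (fun q : (T1 * T2) * T1 => g (q.2, q.1.2)).
    move=> mg.
    have mq : measurable_fun setT (fun q : (T1 * T2) * T1 => (q.2, q.1.2)).
      apply/measurable_fun_pairP; split; first exact: measurable_snd.
      exact: (measurableT_comp measurable_snd measurable_fst).
    exact: (measurableT_comp mg mq).
  have mph : measurable_fun setT (fun q : (T1 * T2) * T1 => th1 q.1.1 q.2).
    have mq : measurable_fun setT (fun q : (T1 * T2) * T1 => (q.1.1, q.2)).
      apply/measurable_fun_pairP; split; last exact: measurable_snd.
      exact: (measurableT_comp measurable_fst measurable_fst).
    exact: (measurableT_comp mth1 mq).
  have mcos := measurableT_comp measurable_cos mph.
  have msin := measurableT_comp measurable_sin mph.
  apply/measurable_EFinP; apply: measurable_funD; apply: measurable_funX.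
    rewrite (_ : (fun _ => _) = fun p => fourier_re m1 (th1 p.1) (fun x => gR (x, p.2)) (fun x => gI (x, p.2))); last first.
      by apply/funext => -[xi eta]; rewrite fourier_re_slice.
    apply: (@measurable_Rintegral_param _ _ _ _ _ m1 (fun q : (T1 * T2) * T1 =>
      gR (q.2, q.1.2) * cos (th1 q.1.1 q.2) + gI (q.2, q.1.2) * sin (th1 q.1.1 q.2))).
    by apply: measurable_funD; apply: measurable_funM => //; exact: mr.
  rewrite (_ : (fun _ => _) = fun p => fourier_im m1 (th1 p.1) (fun x => gR (x, p.2)) (fun x => gI (x, p.2))); last first.
    by apply/funext => -[xi eta]; rewrite fourier_im_slice.
  apply: (@measurable_Rintegral_param _ _ _ _ _ m1 (fun q : (T1 * T2) * T1 =>
    gI (q.2, q.1.2) * cos (th1 q.1.1 q.2) - gR (q.2, q.1.2) * sin (th1 q.1.1 q.2))).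
  by apply: measurable_funB; apply: measurable_funM => //; exact: mr.
have uhat20 xi : (0 <= uhat2 xi)%E by rewrite lee_fin addr_ge0 ?sqr_ge0.
rewrite EFinM -muleA (muleC c2%:E) (muleC _ c2%:E) -iterated_energy.
rewrite (fubini_tonelli E mE E0) (fubini_tonelli2 uhat2 muhat2 uhat20).
rewrite -ge0_integralZl//; last by move=> x _; exact: integral_ge0.
apply: ge0_ae_eq_integral => //.
- exact: (measurable_fun_fubini_tonelli_G uhat2 muhat2 uhat20).
- exact: measurable_funeM.
- by move=> x _; exact: integral_ge0.
- by move=> x _; rewrite mule_ge0 ?lee_fin//; exact: integral_ge0.
apply: filterS ae_L1_L2 => eta [LR LI] _; rewrite /fubini_G /uhat2.
under eq_integral do rewrite fourier_re_slice fourier_im_slice.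
exact: (P1 LR LI).
Qed.

End functions.

Lemma plancherel_product : plancherel_for (m1 \x m2)%E th (c1 * c2).
Proof. by move=> a b La Lb; exact: plancherel_product_aux. Qed.

End plancherel_product.

Section cons_measure_integral.
Context d (T : measurableType d) {R : realType} (n : nat).
Context (m1 : {sigma_finite_measure set T -> \bar R}).
Context (m2 : {sigma_finite_measure set (n.-tuple T) -> \bar R}).
Local Notation cons := (@tuple_cons T n).
Local Notation m := (cons_measure m1 m2).

Let mcons : measurable_fun setT cons.
Proof. exact: measurable_tuple_cons. Qed.

Let mE (f : n.+1.-tuple T -> \bar R) :
  (\int[m]_x f x = \int[pushforward (m1 \x m2)%E cons]_x f x)%E.
Proof. by apply: eq_measure_integral => A mA _. Qed.

Lemma ge0_integral_cons (f : n.+1.-tuple T -> \bar R) : measurable_fun setT f ->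
  (forall x, 0 <= f x)%E -> (\int[m]_x f x = \int[m1 \x m2]_p f (cons p))%E.
Proof. by move=> mf f0; rewrite mE ge0_integral_pushforward. Qed.

Lemma integrable_cons (f : n.+1.-tuple T -> \bar R) :
  m.-integrable setT f -> (m1 \x m2)%E.-integrable setT (f \o cons).
Proof.
move=> /integrableP[mf fi]; apply/integrableP; split; first exact: measurableT_comp.
move: fi; rewrite ge0_integral_cons//; exact: measurableT_comp.
Qed.

Lemma integral_cons (f : n.+1.-tuple T -> \bar R) : m.-integrable setT f ->
  (\int[m]_x f x = \int[m1 \x m2]_p f (cons p))%E.
Proof.
move=> fi; rewrite mE (integral_pushforward mcons)//; last exact: integrable_cons.
exact: measurable_int fi.
Qed.

Lemma in_L1_L2_cons (f : n.+1.-tuple T -> R) :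
  in_L1_L2 m f -> in_L1_L2 (m1 \x m2)%E (f \o cons).
Proof. by move=> [if1 if2]; split; [exact: (integrable_cons if1)|exact: (integrable_cons if2)]. Qed.

(** The measure on tuples is an image measure, along a map that need not be
    inverted: only the integrals are transported. *)
Lemma plancherel_cons (th : n.+1.-tuple T -> n.+1.-tuple T -> R) (c : R) :
  measurable_fun setT (fun p => th p.1 p.2) ->
  plancherel_for (m1 \x m2)%E (fun xi x => th (cons xi) (cons x)) c ->
  plancherel_for m th c.
Proof.
move=> mth P a b La Lb.
have mthx xi : measurable_fun setT (th xi) by exact: (measurableT_comp mth (pair1_measurable xi)).
have ma := in_L1_L2_measurable La; have mb := in_L1_L2_measurable Lb.
have mcs := (measurableT_comp measurable_cos mth, measurableT_comp measurable_sin mth).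
have m2f (f : n.+1.-tuple T -> R) : measurable_fun setT f ->
    measurable_fun setT (fun q : n.+1.-tuple T * n.+1.-tuple T => f q.2).
  by move=> mf; exact: (measurableT_comp mf measurable_snd).
have mre : measurable_fun setT (fun xi => fourier_re m (th xi) a b).
  apply: (@measurable_Rintegral_param _ _ _ _ _ m (fun q => a q.2 * cos (th q.1 q.2) + b q.2 * sin (th q.1 q.2))).
  by apply: measurable_funD; apply: measurable_funM; [exact: m2f|exact: mcs.1|exact: m2f|exact: mcs.2].
have mim : measurable_fun setT (fun xi => fourier_im m (th xi) a b).
  apply: (@measurable_Rintegral_param _ _ _ _ _ m (fun q => b q.2 * cos (th q.1 q.2) - a q.2 * sin (th q.1 q.2))).
  by apply: measurable_funB; apply: measurable_funM; [exact: m2f|exact: mcs.1|exact: m2f|exact: mcs.2].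
have reE xi : fourier_re m (th xi) a b =
    fourier_re (m1 \x m2)%E (fun x => th xi (cons x)) (a \o cons) (b \o cons).
  by congr fine; apply: integral_cons; exact: (integrable_fourier (mthx xi) La.1 Lb.1).1.
have imE xi : fourier_im m (th xi) a b =
    fourier_im (m1 \x m2)%E (fun x => th xi (cons x)) (a \o cons) (b \o cons).
  by congr fine; apply: integral_cons; exact: (integrable_fourier (mthx xi) La.1 Lb.1).2.
rewrite !ge0_integral_cons.
- under eq_integral do rewrite reE imE.
  exact: (P _ _ (in_L1_L2_cons La) (in_L1_L2_cons Lb)).
- by apply/measurable_EFinP; apply: measurable_funD; apply: measurable_funX.
- by move=> x; rewrite lee_fin addr_ge0 ?sqr_ge0.
- by apply/measurable_EFinP; apply: measurable_funD; apply: measurable_funX.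
- by move=> x; rewrite lee_fin addr_ge0 ?sqr_ge0.
Qed.

End cons_measure_integral.

Section plancherel_tuple.
Context {R : realType}.

Lemma measurable_dotn n : measurable_fun setT (fun p : Rn R n * Rn R n => dotn p.1 p.2).
Proof.
apply: measurable_sum => i; apply: measurable_funM.
  exact: (measurableT_comp (measurable_tnth i) measurable_fst).
exact: (measurableT_comp (measurable_tnth i) measurable_snd).
Qed.

Lemma dotnC n (x y : Rn R n) : dotn x y = dotn y x.
Proof. by apply: eq_bigr => i _; rewrite mulrC. Qed.

Lemma measurable_dotn_swap n : measurable_fun setT (fun p : Rn R n * Rn R n => dotn p.2 p.1).
Proof.
rewrite (_ : (fun _ => _) = (fun p => dotn p.1 p.2)); first exact: measurable_dotn.
by apply/funext => p; rewrite dotnC.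
Qed.

Lemma dotn_cons n (p q : measurableTypeR R * Rn R n) :
  dotn (tuple_cons p) (tuple_cons q) = (p.1 : R) * (q.1 : R) + dotn p.2 q.2.
Proof.
rewrite /dotn big_ord_recl; congr (_ + _).
by apply: eq_bigr => i _; rewrite !tnthS.
Qed.

Theorem plancherel_tuple n :
  plancherel_for (lebesgue_tuple R n) (fun xi x => dotn x xi) ((2 * pi) ^+ n).
Proof.
elim: n => [|n IH].
  move=> a b _ _.
  have I0 (f : Rn R 0 -> \bar R) : (\int[lebesgue_tuple R 0]_x f x = f [tuple])%E.
    rewrite (_ : f = cst (f [tuple])); last by apply/funext => x; rewrite (tuple0 x).
    by rewrite integral_cst//= diracT mule1.
  rewrite !I0 expr0 mul1e /fourier_re /fourier_im /Rintegral !I0 /=.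
  by rewrite /dotn big_ord0 cos0 sin0 !mulr1 !mulr0 addr0 subr0.
apply: plancherel_cons.
  exact: measurable_dotn_swap.
rewrite exprS.
pose th1 (xi x : measurableTypeR R) : R := (x : R) * (xi : R).
have P1 : plancherel_for (@lebesgue_measure R) th1 (2 * pi).
  by move=> a b [ia ia2] [ib ib2]; exact: plancherel_line.
have mth1 : measurable_fun setT (fun p : measurableTypeR R * measurableTypeR R => th1 p.1 p.2).
  by apply: measurable_funM; [exact: measurable_snd|exact: measurable_fst].
have mth2 : measurable_fun setT (fun p : Rn R n * Rn R n => dotn p.2 p.1).
  exact: measurable_dotn_swap.
have tpi : 0 <= 2 * pi :> R by rewrite mulr_ge0// pi_ge0.
have := plancherel_product mth1 mth2 P1 IH tpi (exprn_ge0 n tpi).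
rewrite (_ : (fun xi x => dotn (tuple_cons x) (tuple_cons xi)) = (fun xi x => th1 xi.1 x.1 + dotn x.2 xi.2))//.
by apply/funext => xi; apply/funext => x; rewrite dotn_cons.
Qed.

End plancherel_tuple.

(** * The energy of a field *)

Section cnorm.
Context {R : realType} {n : nat}.
Implicit Types z w : 'cV[R[i]]_n.

Lemma cnorm_sqr z :
  cnorm z ^+ 2 = \sum_(j < n) (complex.Re (z j 0) ^+ 2 + complex.Im (z j 0) ^+ 2).
Proof. by rewrite /cnorm sqr_sqrtr// sumr_ge0// => j _; rewrite addr_ge0 ?sqr_ge0. Qed.

Lemma cnormN z : cnorm (- z) = cnorm z.
Proof.
rewrite /cnorm; congr Num.sqrt; apply: eq_bigr => j _; rewrite mxE.
by case: (z j 0) => x y /=; rewrite !sqrrN.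
Qed.

Lemma cnorm_sqr_eq0 z : cnorm z ^+ 2 = 0 -> z = 0.
Proof.
rewrite cnorm_sqr => /eqP; rewrite psumr_eq0; last by move=> j _; rewrite addr_ge0 ?sqr_ge0.
move=> /allP z0; apply/matrixP => j k; rewrite ord1 mxE.
have := z0 j (mem_index_enum j); rewrite paddr_eq0 ?sqr_ge0// !sqrf_eq0.
by case: (z j 0) => x y /= /andP[/eqP -> /eqP ->].
Qed.

(** From [2 p q <= delta p^2 + delta^-1 q^2], componentwise. A free [delta] lets
    the factor of the first term tend to 1 in limit arguments. *)
Lemma cnorm_sqrD (delta : R) z w : 0 < delta ->
  cnorm (z + w) ^+ 2 <= (1 + delta) * cnorm z ^+ 2 + (1 + delta^-1) * cnorm w ^+ 2.
Proof.
move=> d0; rewrite !cnorm_sqr !mulr_sumr -big_split; apply: ler_sum => j _ /=; rewrite mxE.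
have real (x y : R) : (x + y) ^+ 2 <= (1 + delta) * x ^+ 2 + (1 + delta^-1) * y ^+ 2.
  rewrite -subr_ge0 (_ : _ - _ = delta^-1 * (delta * x - y) ^+ 2).
    by rewrite mulr_ge0 ?sqr_ge0// invr_ge0 ltW.
  by field; rewrite gt_eqF.
case: (z j 0) (w j 0) => [a b] [c e] /=.
by apply: le_trans (lerD (real a c) (real b e)) _; rewrite le_eqVlt; apply/orP; left; apply/eqP; ring.
Qed.

End cnorm.

Section energy.
Context {R : realType} {n : nat}.
Local Notation mu := (lebesgue_tuple R n).
Implicit Types u w : vfield R n.

(** The squared norm written as an integral, which is additive in the field's
    components and monotone in the integrand. *)
Definition energy u : \bar R := (\int[mu]_x (cnorm (u x) ^+ 2)%:E)%E.

Lemma energy_ge0 u : (0 <= energy u)%E.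
Proof. by apply: integral_ge0 => x _; rewrite lee_fin sqr_ge0. Qed.

Lemma L2norm_sqr u : (L2norm u ^+ 2 = energy u)%E.
Proof.
have -> : (L2norm u ^+ 2 = poweR (L2norm u) 2)%E.
  have := Lnorm_ge0 mu 2%:E (fun x => (cnorm (u x))%:E); rewrite -/(L2norm u).
  case: (L2norm u) => [r| |]//.
    by rewrite lee_fin => r0; rewrite -EFin_expe -powR_mulrn.
  by rewrite poweRyr// expe2 mulyy.
rewrite /L2norm poweR_Lnorm//; apply: eq_integral => x _.
by rewrite /= powR_mulrn// real_normK ?num_real.
Qed.

Lemma measurable_cnorm_sqr u : measurable_field u ->
  measurable_fun setT (fun x => cnorm (u x) ^+ 2).
Proof.
move=> mfu; under eq_fun do rewrite cnorm_sqr.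
by apply: measurable_sum => j; apply: measurable_funD; apply: measurable_funX; case: (mfu j).
Qed.

Lemma L2norm_lty u : (L2norm u < +oo)%E = (energy u < +oo)%E.
Proof.
rewrite -L2norm_sqr; have := Lnorm_ge0 mu 2%:E (fun x => (cnorm (u x))%:E); rewrite -/(L2norm u).
by case: (L2norm u) => [r| |]// _; rewrite -EFin_expe !ltry.
Qed.

Lemma measurable_fieldD u w : measurable_field u -> measurable_field w ->
  measurable_field (fun x => u x + w x).
Proof.
move=> mfu mfw j; have [m1 m2] := mfu j; have [m3 m4] := mfw j.
split.
  rewrite (_ : (fun _ => _) = (fun x => complex.Re (u x j 0) + complex.Re (w x j 0))).
    exact: measurable_funD.
  by apply/funext => x; rewrite mxE; case: (u x j 0) (w x j 0) => ? ? [].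
rewrite (_ : (fun _ => _) = (fun x => complex.Im (u x j 0) + complex.Im (w x j 0))).
  exact: measurable_funD.
by apply/funext => x; rewrite mxE; case: (u x j 0) (w x j 0) => ? ? [].
Qed.

Lemma measurable_fieldN u : measurable_field u -> measurable_field (fun x => - u x).
Proof.
move=> mfu j; have [m1 m2] := mfu j.
split.
  rewrite (_ : (fun _ => _) = (fun x => - complex.Re (u x j 0))).
    exact: (measurableT_comp (@oppr_measurable R setT) m1).
  by apply/funext => x; rewrite mxE; case: (u x j 0).
rewrite (_ : (fun _ => _) = (fun x => - complex.Im (u x j 0))).
  exact: (measurableT_comp (@oppr_measurable R setT) m2).
by apply/funext => x; rewrite mxE; case: (u x j 0).
Qed.

Lemma energyN u : energy (fun x => - u x) = energy u.
Proof. by apply: eq_integral => x _; rewrite cnormN. Qed.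

Lemma energyD (delta : R) u w : 0 < delta -> measurable_field u -> measurable_field w ->
  (energy (fun x => u x + w x)%R <=
   (1 + delta)%:E * energy u + (1 + delta^-1)%:E * energy w)%E.
Proof.
move=> d0 mfu mfw.
have d1 : 0 <= 1 + delta by rewrite addr_ge0// ltW.
have d2 : 0 <= 1 + delta^-1 by rewrite addr_ge0// invr_ge0 ltW.
have mc (v : vfield R n) : measurable_field v -> measurable_fun setT (fun x => (cnorm (v x) ^+ 2)%:E).
  by move=> mv; apply/measurable_EFinP; exact: (measurable_cnorm_sqr mv).
have c0 (v : vfield R n) (x : Rn R n) : setT x -> (0 <= (cnorm (v x) ^+ 2)%:E :> \bar R)%E by rewrite lee_fin sqr_ge0.
rewrite /energy -(ge0_integralZl _ measurableT (mc _ mfu) (c0 u))//.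
rewrite -(ge0_integralZl _ measurableT (mc _ mfw) (c0 w))//.
have mk (k : R) (v : vfield R n) : measurable_field v -> measurable_fun setT (fun x => k%:E * (cnorm (v x) ^+ 2)%:E)%E.
  by move=> mv; apply: measurable_funeM; exact: (mc v mv).
have k0 (k : R) (v : vfield R n) (x : Rn R n) : 0 <= k -> setT x -> (0 <= k%:E * (cnorm (v x) ^+ 2)%:E)%E.
  by move=> k0 _; rewrite mule_ge0 ?lee_fin ?sqr_ge0.
rewrite -(ge0_integralD _ measurableT (fun x => k0 _ u x d1) (mk _ _ mfu) (fun x => k0 _ w x d2) (mk _ _ mfw)).
apply: ge0_le_integral => //.
- by move=> x _; rewrite lee_fin sqr_ge0.
- exact: (mc _ (measurable_fieldD mfu mfw)).
- exact: (emeasurable_funD (mk _ _ mfu) (mk _ _ mfw)).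
by move=> x _; rewrite -!EFinM -EFinD lee_fin cnorm_sqrD.
Qed.

Lemma energy_eq0 u : measurable_field u -> energy u = 0%E -> {ae mu, forall x, u x = 0}.
Proof.
move=> m0 E0.
have mc : measurable_fun setT (fun x => (cnorm (u x) ^+ 2)%:E).
  by apply/measurable_EFinP; exact: (measurable_cnorm_sqr m0).
have : ae_eq mu setT (fun x => (cnorm (u x) ^+ 2)%:E) (cst 0%E).
  apply/ae_eq_integral_abs => //; rewrite -[RHS]E0; apply: eq_integral => x _.
  by rewrite gee0_abs// lee_fin sqr_ge0.
by apply: filterS => x /(_ I) [] /cnorm_sqr_eq0.
Qed.

End energy.

(** * The transform of a square-integrable field *)

Section balls.
Context {R : realType} {n : nat}.
Local Notation mu := (lebesgue_tuple R n).

Lemma measurable_enorm : measurable_fun setT (@enorm R n).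
Proof.
apply: (measurableT_comp (continuous_measurable_fun (@sqrt_continuous R))).
apply: measurable_sum => i; apply: measurable_funM; exact: measurable_tnth.
Qed.

Lemma measurable_ball0 (rho : R) : measurable (@Defs.ball0 R n rho).
Proof.
rewrite (_ : Defs.ball0 rho = setT `&` @enorm R n @^-1` `]-oo, rho[%classic).
  exact: (measurable_enorm measurableT).
by rewrite setTI; apply/seteqP; split => x /=; rewrite in_itv.
Qed.

Lemma dotn_ge0 (x : Rn R n) : 0 <= dotn x x.
Proof. by apply: sumr_ge0 => i _; rewrite -expr2 sqr_ge0. Qed.

Lemma enorm_ge0 (x : Rn R n) : 0 <= enorm x.
Proof. exact: sqrtr_ge0. Qed.

Lemma tnth_le_enorm (x : Rn R n) (i : 'I_n) : `|tnth x i : R| <= enorm x.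
Proof.
rewrite -(ler_sqr (normr_ge0 _) (enorm_ge0 x)) sqr_sqrtr ?dotn_ge0// real_normK ?num_real//.
by rewrite /dotn (bigD1 i)//= -expr2 lerDl sumr_ge0// => j _; rewrite -expr2 sqr_ge0.
Qed.

Lemma ball0_fin (rho : R) : (mu (@Defs.ball0 R n rho) < +oo)%E.
Proof.
pose A (i : 'I_n) : set (measurableTypeR R) := `[- rho, rho]%classic.
have mA i : measurable (A i) by exact: measurable_itv.
apply: (@le_lt_trans _ _ (mu [set x : Rn R n | forall i, A i (tnth x i)])).
  apply: le_measure; rewrite ?inE; [exact: measurable_ball0|exact: measurable_tuple_box|].
  move=> x /ltW xr i; rewrite /A/= in_itv/= -ler_norml; exact: le_trans (tnth_le_enorm x i) xr.
rewrite lebesgue_tuple_box//.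
apply: (big_rec (fun y : \bar R => (y < +oo)%E)) => [|i x _ xoo]; first exact: ltry.
rewrite lebesgue_measure_itv/=; case: ifP => [rr|_]; last by rewrite mul0e ltry.
by apply: lte_mul_pinfty => //; move: rr; rewrite lee_fin lte_fin opprK; lra.
Qed.

Lemma bigcup_ball0 : \bigcup_N (@Defs.ball0 R n N%:R) = setT.
Proof.
apply/seteqP; split => // x _.
exists (Num.truncn (enorm x)).+1 => //; rewrite /Defs.ball0/=.
by rewrite truncnS_gt.
Qed.

Lemma nondecreasing_ball0 : nondecreasing_seq (fun N : nat => @Defs.ball0 R n N%:R).
Proof.
move=> N N' NN'; apply/subsetPset => x /= xN; apply: lt_le_trans xN _.
by rewrite ler_nat.
Qed.

End balls.

Section truncated_transform.
Context {R : realType} {n : nat}.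
Local Notation mu := (lebesgue_tuple R n).
Variables (u : vfield R n) (D : set (Rn R n)).
Hypotheses (uL2 : in_L2 u) (mD : measurable D) (Dfin : (mu D < +oo)%E).

Let re (j : 'I_n) : Rn R n -> R := (fun x => complex.Re (u x j 0)) \_ D.
Let im (j : 'I_n) : Rn R n -> R := (fun x => complex.Im (u x j 0)) \_ D.

(** On a set of finite measure, square integrability gives integrability by
    [|p| <= p^2 + 1]. *)
Lemma in_L1_L2_restrict (f : Rn R n -> R) : measurable_fun setT f ->
  (forall x, f x ^+ 2 <= cnorm (u x) ^+ 2) -> in_L1_L2 mu (f \_ D).
Proof.
move=> mf fu.
have [mfu Lu] := uL2.
have iu : mu.-integrable setT (fun x => (cnorm (u x) ^+ 2)%:E).
  apply/integrableP; split; first by apply/measurable_EFinP; exact: measurable_cnorm_sqr.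
  under eq_integral do rewrite gee0_abs ?lee_fin ?sqr_ge0//.
  by rewrite L2norm_lty in Lu.
have i1 : mu.-integrable setT (EFin \o \1_D).
  apply/integrableP; split; first by apply/measurable_EFinP; exact: measurable_indic.
  under eq_integral do rewrite /= ger0_norm//.
  by rewrite integral_indic// setIT.
have mfD : measurable_fun setT (f \_ D) by apply/measurable_restrict => //; exact: measurable_funS mf.
have fDE x : (f \_ D) x = f x * \1_D x.
  by rewrite patchE indicE; case: ifP => _; rewrite ?mulr1 ?mulr0.
split.
  apply: (le_integrable _ _ _ (integrableD measurableT iu i1)) => //; first exact/measurable_EFinP.
  move=> x _ /=; rewrite lee_fin fDE indicE; case: (x \in D); last by rewrite mulr0 normr0.
  rewrite mulr1 [leRHS]ger0_norm ?addr_ge0 ?sqr_ge0//.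
  apply: le_trans (_ : f x ^+ 2 + 1 <= _); last by rewrite lerD2r.
  rewrite -[X in X + 1]real_normK ?num_real// -subr_ge0.
  rewrite (_ : _ - _ = (`|f x| - 2^-1) ^+ 2 + 3 / 4); last by field.
  by rewrite addr_ge0 ?sqr_ge0// divr_ge0.
apply: (le_integrable _ _ _ iu) => //; first by apply/measurable_EFinP; exact: measurable_funX.
move=> x _ /=; rewrite lee_fin fDE !ger0_norm ?sqr_ge0//; apply: le_trans (fu x).
by rewrite exprMn ler_piMr ?sqr_ge0// indicE; case: (x \in D); rewrite ?expr1n ?expr0n.
Qed.

Lemma in_L1_L2_components (j : 'I_n) : in_L1_L2 mu (re j) /\ in_L1_L2 mu (im j).
Proof.
have [mfu _] := uL2; have [m1 m2] := mfu j.
have le x : complex.Re (u x j 0) ^+ 2 + complex.Im (u x j 0) ^+ 2 <= cnorm (u x) ^+ 2.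
  by rewrite cnorm_sqr [leRHS](bigD1 j)//= lerDl sumr_ge0// => k _; rewrite addr_ge0 ?sqr_ge0.
split; apply: in_L1_L2_restrict => // x; apply: le_trans (le x).
  by rewrite lerDl sqr_ge0.
by rewrite lerDr sqr_ge0.
Qed.

Lemma fourier_integralE (xi : Rn R n) (j : 'I_n) :
  fourier_integral D u xi j 0 =
  (fourier_re mu (fun x => dotn x xi) (re j) (im j) +i*
   fourier_im mu (fun x => dotn x xi) (re j) (im j))%C.
Proof.
rewrite mxE /Cintegral; congr (_ +i* _)%C; rewrite Rintegral_mkcond; apply: eq_Rintegral => x _;
  rewrite /re /im !patchE; case: ifP => _; rewrite ?mul0r ?addr0 ?subr0//;
  rewrite /expi cosN sinN; case: (u x j 0) => a b /=; ring.
Qed.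

Lemma measurable_fourier_integral : measurable_field (fourier_integral D u).
Proof.
move=> j; have [Lre Lim] := in_L1_L2_components j.
have mth := @measurable_dotn_swap R n.
have mcs := (measurableT_comp measurable_cos mth, measurableT_comp measurable_sin mth).
have m2 (f : Rn R n -> R) : in_L1_L2 mu f -> measurable_fun setT (fun q : Rn R n * Rn R n => f q.2).
  by move=> Lf; exact: (measurableT_comp (in_L1_L2_measurable Lf) measurable_snd).
split.
  rewrite (_ : (fun _ => _) = fun xi => fourier_re mu (fun x => dotn x xi) (re j) (im j)); last first.
    by apply/funext => xi; rewrite fourier_integralE.
  apply: (@measurable_Rintegral_param _ _ _ _ _ mu (fun q : Rn R n * Rn R n =>
    re j q.2 * cos (dotn q.2 q.1) + im j q.2 * sin (dotn q.2 q.1))).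
  by apply: measurable_funD; apply: measurable_funM; [exact: m2|exact: mcs.1|exact: m2|exact: mcs.2].
rewrite (_ : (fun _ => _) = fun xi => fourier_im mu (fun x => dotn x xi) (re j) (im j)); last first.
  by apply/funext => xi; rewrite fourier_integralE.
apply: (@measurable_Rintegral_param _ _ _ _ _ mu (fun q : Rn R n * Rn R n =>
  im j q.2 * cos (dotn q.2 q.1) - re j q.2 * sin (dotn q.2 q.1))).
by apply: measurable_funB; apply: measurable_funM; [exact: m2|exact: mcs.1|exact: m2|exact: mcs.2].
Qed.

(** Componentwise, this is Plancherel's identity for the restriction to [D], which
    is both integrable and square integrable. *)
Lemma energy_fourier_integral :
  (energy (fourier_integral D u) =
   ((2 * pi) ^+ n)%:E * \int[mu]_(x in D) (cnorm (u x) ^+ 2)%:E)%E.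
Proof.
have mF := measurable_fourier_integral.
have msum (v : vfield R n) j : measurable_field v ->
    measurable_fun setT (fun x => (complex.Re (v x j 0) ^+ 2 + complex.Im (v x j 0) ^+ 2)%:E).
  move=> mv; have [m1 m2] := mv j.
  by apply/measurable_EFinP; apply: measurable_funD; apply: measurable_funX.
have ge0 (z : R[i]) : (0 <= (complex.Re z ^+ 2 + complex.Im z ^+ 2)%:E :> \bar R)%E.
  by rewrite lee_fin addr_ge0 ?sqr_ge0.
have split (v : vfield R n) (A : set (Rn R n)) : measurable A -> measurable_field v ->
    (\int[mu]_(x in A) (cnorm (v x) ^+ 2)%:E =
     \sum_(j < n) \int[mu]_(x in A) (complex.Re (v x j 0) ^+ 2 + complex.Im (v x j 0) ^+ 2)%:E)%E.
  move=> mA mv; rewrite -ge0_integral_sum//.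
    by apply: eq_integral => x _; rewrite cnorm_sqr sumEFin.
  by move=> j; apply: measurable_funTS; exact: msum.
rewrite /energy split// split//; last by case: uL2.
rewrite ge0_sume_distrr; last by move=> j _; exact: integral_ge0.
apply: eq_bigr => j _; have [Lre Lim] := in_L1_L2_components j.
under eq_integral do rewrite fourier_integralE/=.
rewrite (plancherel_tuple Lre Lim) [in RHS]integral_mkcond; congr (_ * _)%E.
apply: eq_integral => x _; rewrite /re /im !patchE.
by case: ifP => // _; rewrite expr0n addr0.
Qed.

End truncated_transform.

Section plancherel.
Context {R : realType} {n : nat}.
Local Notation mu := (lebesgue_tuple R n).
Implicit Types u w v : vfield R n.

Lemma energy_cvg0 (w : nat -> vfield R n) :
  L2norm (w N) @[N --> \oo] --> 0%E -> energy (w N) @[N --> \oo] --> 0%E.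
Proof.
move=> w0; rewrite (_ : (fun N => energy (w N)) = (fun N => L2norm (w N) * L2norm (w N))%E).
  by rewrite -[X in _ --> X](mule0 0%E); apply: cvgeM.
by apply/funext => N; rewrite -L2norm_sqr expe2.
Qed.

Lemma energy_restrict_cvg u : measurable_field u ->
  (\int[mu]_(x in Defs.ball0 N%:R) (cnorm (u x) ^+ 2)%:E)%E @[N --> \oo] --> energy u.
Proof.
move=> mfu; rewrite /energy -bigcup_ball0; apply: ge0_nondecreasing_set_cvg_integral.
- exact: nondecreasing_ball0.
- by move=> N; exact: measurable_ball0.
- by move=> N; apply: measurable_funTS; apply/measurable_EFinP; exact: (measurable_cnorm_sqr mfu).
- by move=> N x _; rewrite lee_fin sqr_ge0.
Qed.

Lemma fourier_remainder u uhat : is_fourier u uhat ->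
  energy (fun xi => fourier_integral (Defs.ball0 N%:R) u xi - uhat xi) @[N --> \oo] --> 0%E.
Proof. by move=> [_ _ h]; exact: (@energy_cvg0 (fun N xi => fourier_integral (Defs.ball0 N%:R) u xi - uhat xi)). Qed.

(** Absorbs the factor [1 + delta] left by [energyD]. *)
Lemma le_of_small_factors (x y : \bar R) : (0 <= y)%E -> (y < +oo)%E ->
  (forall delta : R, 0 < delta -> (x <= (1 + delta)%:E * y)%E) -> (x <= y)%E.
Proof.
move=> y0 yoo H; apply/lee_addgt0Pr => e e0.
have fy : y \is a fin_num by rewrite ge0_fin_numE.
have y1 : 0 < fine y + 1 by rewrite ltr_wpDl// fine_ge0.
apply: le_trans (H (e / (fine y + 1)) (divr_gt0 e0 y1)) _.
rewrite -(fineK fy) -EFinM -EFinD lee_fin mulrDl mul1r lerD2l mulrAC ler_pdivrMr//.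
by rewrite ler_wpM2l ?lerDl// ltW.
Qed.

(** The truncated transforms have energy [(2 pi)^n] times that of the truncated
    field, and they differ from [uhat] by remainders of vanishing energy. Both
    inequalities follow by removing the truncation first and then letting [delta]
    tend to 0. *)
Theorem fourier_energy u uhat : is_fourier u uhat ->
  energy uhat = (((2 * pi) ^+ n)%:E * energy u)%E.
Proof.
move=> Hu; have [uL2 uhL2 _] := Hu; have [mu_ Lu] := uL2; have [mh Lh] := uhL2.
rewrite L2norm_lty in Lu; rewrite L2norm_lty in Lh.
pose F (N : nat) := fourier_integral (Defs.ball0 N%:R) u.
pose w N := fun xi => F N xi - uhat xi.
have c0 : 0 <= (2 * pi) ^+ n :> R by rewrite exprn_ge0// mulr_ge0// pi_ge0.
have mF N : measurable_field (F N).
  by apply: measurable_fourier_integral => //; [exact: measurable_ball0|exact: ball0_fin].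
have mw N : measurable_field (w N) by exact: (measurable_fieldD (mF N) (measurable_fieldN mh)).
have w0 : energy (w N) @[N --> \oo] --> 0%E := fourier_remainder Hu.
have FK : energy (F N) @[N --> \oo] --> (((2 * pi) ^+ n)%:E * energy u)%E.
  rewrite (_ : (fun N => energy (F N)) = (fun N => ((2 * pi) ^+ n)%:E *
      \int[mu]_(x in Defs.ball0 N%:R) (cnorm (u x) ^+ 2)%:E)%E); last first.
    by apply/funext => N; rewrite -(energy_fourier_integral uL2 (measurable_ball0 _) (ball0_fin _)).
  by apply: cvgeZl => //; exact: energy_restrict_cvg.
have K0 : (0 <= ((2 * pi) ^+ n)%:E * energy u)%E by rewrite mule_ge0 ?lee_fin ?energy_ge0.
have Koo : (((2 * pi) ^+ n)%:E * energy u < +oo)%E by rewrite lte_mul_pinfty ?lee_fin.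
have perturb (delta : R) (x : \bar R) (f : nat -> \bar R) : 0 < delta -> f N @[N --> \oo] --> x ->
    x \is a fin_num ->
    ((1 + delta)%:E * f N + (1 + delta^-1)%:E * energy (w N))%E @[N --> \oo] --> ((1 + delta)%:E * x)%E.
  move=> d0 fx xf; rewrite -[X in _ --> X]adde0; apply: cvgeD.
  - by rewrite fin_num_adde_defl.
  - exact: cvgeZl.
  - by rewrite -[X in _ --> X](mule0 (1 + delta^-1)%:E); apply: cvgeZl.
apply/eqP; rewrite eq_le; apply/andP; split; apply: le_of_small_factors => //.
- move=> delta d0; apply: (lee_cvg_to (cvg_cst _) (perturb _ _ _ d0 FK _)).
    by rewrite ge0_fin_numE.
  apply: nearW => N.
  have -> : energy uhat = energy (fun xi => F N xi + - w N xi).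
    by congr energy; apply/funext => xi; rewrite /w opprB addrC subrK.
  by rewrite -(energyN (w N)); exact: (energyD d0 (mF N) (measurable_fieldN (mw N))).
- exact: energy_ge0.
- move=> delta d0; apply: (lee_cvg_to FK (perturb _ _ _ d0 (cvg_cst (energy uhat)) _)).
    by rewrite ge0_fin_numE ?energy_ge0.
  apply: nearW => N.
  have -> : energy (F N) = energy (fun xi => uhat xi + w N xi).
    by congr energy; apply/funext => xi; rewrite /w addrC subrK.
  exact: (energyD d0 mh (mw N)).
Qed.

(** Two transforms of the same field differ by two remainders, so their difference
    has energy 0. *)
Theorem fourier_unique u uhat1 uhat2 : is_fourier u uhat1 -> is_fourier u uhat2 ->
  {ae mu, forall xi, uhat1 xi = uhat2 xi}.
Proof.
move=> H1 H2.
have [[mfu Lu] [m1 _] _] := H1; have [_ [m2 _] _] := H2.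
have uL2 : in_L2 u by split.
pose F (N : nat) := fourier_integral (Defs.ball0 N%:R) u.
have mF N : measurable_field (F N).
  by apply: measurable_fourier_integral => //; [exact: measurable_ball0|exact: ball0_fin].
pose w1 N := fun xi => F N xi - uhat1 xi.
pose w2 N := fun xi => F N xi - uhat2 xi.
have mw1 N : measurable_field (w1 N) by exact: (measurable_fieldD (mF N) (measurable_fieldN m1)).
have mw2 N : measurable_field (w2 N) by exact: (measurable_fieldD (mF N) (measurable_fieldN m2)).
have m12 : measurable_field (fun xi => uhat1 xi - uhat2 xi) by exact: (measurable_fieldD m1 (measurable_fieldN m2)).
have E12 : energy (fun xi => uhat1 xi - uhat2 xi) = 0%E.
  apply/eqP; rewrite eq_le energy_ge0 andbT.
  have c0 : ((1 + 1)%:E * energy (w2 N) + (1 + 1^-1)%:E * energy (w1 N))%E @[N --> \oo] --> (0%E : \bar R).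
    rewrite -[X in _ --> X]adde0 -[X in _ --> (X + _)%E](mule0 (1 + 1)%:E) -[X in _ --> (_ + X)%E](mule0 (1 + 1^-1)%:E).
    by apply: cvgeD; [rewrite !mule0|apply: cvgeZl => //; exact: (fourier_remainder H2)
      |apply: cvgeZl => //; exact: (fourier_remainder H1)].
  apply: (lee_cvg_to (cvg_cst _) c0); apply: nearW => N.
  have -> : energy (fun xi => uhat1 xi - uhat2 xi) = energy (fun xi => w2 N xi + - w1 N xi).
    by congr energy; apply/funext => xi; rewrite /w1 /w2 opprB [RHS]addrC addrA subrK.
  by rewrite -(energyN (w1 N)); exact: (energyD ltr01 (mw2 N) (measurable_fieldN (mw1 N))).
by apply: filterS (energy_eq0 m12 E12) => xi /eqP; rewrite subr_eq0 => /eqP.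
Qed.

End plancherel.

(** * The exponential of the symbol *)

Section matrix_exponential.
Context {R : realType} {n : nat}.
Implicit Types (P : 'M[R]_n) (v : 'rV[R]_n).

Lemma orthogonal_invmx P : P^T *m P = 1%:M -> invmx P = P^T.
Proof.
move=> PP; have [_ uP] := mulmx1_unit PP.
by rewrite -[invmx P]mul1mx -PP -mulmxA mulmxV// mulmx1.
Qed.

Lemma diag_mxX v (k : nat) : diag_mx v ^+ k = diag_mx (map_mx (fun x => x ^+ k) v).
Proof.
elim: k => [|k IH].
  rewrite expr0; apply/matrixP => i j; rewrite !mxE expr0.
  by case: eqP.
by rewrite exprS IH -mulmxE mulmx_diag; congr diag_mx; apply/rowP => i; rewrite !mxE exprS.
Qed.

Lemma orthogonal_conjX P v (k : nat) : P^T *m P = 1%:M ->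
  (P^T *m diag_mx v *m P) ^+ k = P^T *m diag_mx (map_mx (fun x => x ^+ k) v) *m P.
Proof.
move=> PP; have PP' := mulmx1C PP.
rewrite -diag_mxX; elim: k => [|k IH]; first by rewrite !expr0 mulmx1.
rewrite exprS IH -mulmxE -!mulmxA (mulmxA P P^T) PP' mul1mx exprS -mulmxE.
by rewrite !mulmxA.
Qed.

Lemma orthogonal_conj_entry P v (i j : 'I_n) :
  (P^T *m diag_mx v *m P) i j = \sum_l P l i * v 0 l * P l j.
Proof. by rewrite mxE; apply: eq_bigr => l _; rewrite mul_mx_diag !mxE. Qed.

(** The conjugation factors out of the partial sums of the exponential series,
    leaving scalar series on the diagonal. *)
Theorem mexp_orthogonal_conj P v : P^T *m P = 1%:M ->
  mexp (P^T *m diag_mx v *m P) = P^T *m diag_mx (map_mx expR v) *m P.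
Proof.
move=> PP; apply/matrixP => i j; rewrite mxE orthogonal_conj_entry.
apply: (cvg_lim (@Rhausdorff R)).
rewrite (_ : (fun N : nat => _) = (fun N : nat => \sum_l P l i * series (exp_coeff (v 0 l)) N * P l j)).
  apply: cvg_big => [|l _]; first exact: (@add_continuous R^o).
  rewrite mxE; apply: cvgM; last exact: cvg_cst.
  by apply: cvgM; [exact: cvg_cst|exact: is_cvg_series_exp_coeff].
apply/funext => N; rewrite summxE.
under eq_bigr do rewrite mxE orthogonal_conjX// orthogonal_conj_entry mulr_sumr.
rewrite exchange_big; apply: eq_bigr => l _ /=.
rewrite /series/= big_mkord mulr_sumr mulr_suml; apply: eq_bigr => k _.
by rewrite mxE /exp_coeff/=; ring.
Qed.

(** Squared length of a real column. The real matrix acts separately on the real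
    and the imaginary parts of a complex column, so the estimates reduce to the
    real case. *)
Definition sqn (x : 'cV[R]_n) : R := \sum_j x j 0 ^+ 2.

Lemma sqnE (x : 'cV[R]_n) : sqn x = (x^T *m x) 0 0.
Proof. by rewrite mxE; apply: eq_bigr => j _; rewrite mxE expr2. Qed.

Lemma sqn_orthogonal P (x : 'cV[R]_n) : P^T *m P = 1%:M -> sqn (P *m x) = sqn x.
Proof. by move=> PP; rewrite !sqnE trmx_mul -mulmxA (mulmxA P^T) PP mul1mx. Qed.

Lemma sqn_orthogonal_conj P v (x : 'cV[R]_n) (lo hi : R) : P^T *m P = 1%:M ->
  0 <= lo -> (forall l, lo <= v 0 l <= hi) ->
  lo ^+ 2 * sqn x <= sqn (P^T *m diag_mx v *m P *m x) <= hi ^+ 2 * sqn x.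
Proof.
move=> PP lo0 vb; have PP' : P^T^T *m P^T = 1%:M by rewrite trmxK; exact: mulmx1C.
rewrite -!mulmxA (sqn_orthogonal _ PP') -(sqn_orthogonal x PP).
move: (P *m x) => y; rewrite /sqn !mulr_sumr; apply/andP; split; apply: ler_sum => l _.
  rewrite mul_diag_mx mxE exprMn ler_wpM2r ?sqr_ge0// ler_sqr ?nnegrE//; case/andP: (vb l) => // h _.
  exact: le_trans h.
rewrite mul_diag_mx mxE exprMn ler_wpM2r ?sqr_ge0// ler_sqr ?nnegrE//; case/andP: (vb l) => // h h'.
  exact: le_trans h.
by rewrite (le_trans lo0)// (le_trans h).
Qed.

Lemma cnorm_sqr_parts (z : 'cV[R[i]]_n) :
  cnorm z ^+ 2 = sqn (map_mx (@complex.Re R) z) + sqn (map_mx (@complex.Im R) z).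
Proof.
by rewrite cnorm_sqr /sqn -big_split; apply: eq_bigr => j _; rewrite !mxE.
Qed.

Lemma Re_mulmx (A : 'M[R]_n) (z : 'cV[R[i]]_n) :
  map_mx (@complex.Re R) (map_mx (real_complex R) A *m z) = A *m map_mx (@complex.Re R) z.
Proof.
apply/matrixP => i j; rewrite !mxE raddf_sum; apply: eq_bigr => k _; rewrite !mxE.
by case: (z k j) => x y /=; rewrite mul0r subr0.
Qed.

Lemma Im_mulmx (A : 'M[R]_n) (z : 'cV[R[i]]_n) :
  map_mx (@complex.Im R) (map_mx (real_complex R) A *m z) = A *m map_mx (@complex.Im R) z.
Proof.
apply/matrixP => i j; rewrite !mxE raddf_sum; apply: eq_bigr => k _; rewrite !mxE.
by case: (z k j) => x y /=; rewrite mul0r addr0.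
Qed.

Lemma cnorm_orthogonal_conj P v (z : 'cV[R[i]]_n) (lo hi : R) : P^T *m P = 1%:M ->
  0 <= lo -> (forall l, lo <= v 0 l <= hi) ->
  lo ^+ 2 * cnorm z ^+ 2 <=
    cnorm (map_mx (real_complex R) (P^T *m diag_mx v *m P) *m z) ^+ 2 <= hi ^+ 2 * cnorm z ^+ 2.
Proof.
move=> PP lo0 vb; rewrite !cnorm_sqr_parts Re_mulmx Im_mulmx !mulrDr.
have /andP[h1 h2] := sqn_orthogonal_conj (map_mx (@complex.Re R) z) PP lo0 vb.
have /andP[h3 h4] := sqn_orthogonal_conj (map_mx (@complex.Im R) z) PP lo0 vb.
by rewrite !lerD.
Qed.

End matrix_exponential.

Section symbol.
Context {R : realType} {n : nat}.
Variables (alpha : R) (c : 'I_n -> R) (c0 c1 : R).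
Hypotheses (cb : forall i, c0 <= c i <= c1).

(** In the frame [P] the exponential is diagonal with entries
    [exp(- c_i t |xi|^(2 alpha))]; changes of orthonormal frame preserve length. *)
Lemma cnorm_mexp_symbol (P M : 'M[R]_n) (xi : Rn R n) (t : R) (z : 'cV[R[i]]_n) :
  0 <= t -> P^T *m P = 1%:M -> M = invmx P *m frac_diag alpha c xi *m P ->
  expR (- (2 * c1 * t * enorm xi `^ (2 * alpha))) * cnorm z ^+ 2 <=
    cnorm (map_mx (real_complex R) (mexp (t *: M)) *m z) ^+ 2 <=
  expR (- (2 * c0 * t * enorm xi `^ (2 * alpha))) * cnorm z ^+ 2.
Proof.
move=> t0 PP ->; rewrite orthogonal_invmx//.
set s := enorm xi `^ (2 * alpha); have s0 : 0 <= s by exact: powR_ge0.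
have -> : t *: (P^T *m frac_diag alpha c xi *m P) =
    P^T *m diag_mx (\row_i (- (c i * t * s))) *m P.
  rewrite scalemxAl scalemxAr; congr (_ *m _ *m _); apply/matrixP => i j.
  rewrite !mxE -/s; case: eqP => _ /=; first by rewrite mulr1 mulr1n; ring.
  by rewrite !mulr0 mulr0n.
rewrite mexp_orthogonal_conj//.
have E (k : R) : expR (- (2 * k * t * s)) = expR (- (k * t * s)) ^+ 2.
  by rewrite -expRM_natl; congr expR; ring.
rewrite !E; apply: cnorm_orthogonal_conj => //.
move=> l; rewrite !mxE !ler_expR !lerN2; have [h1 h2] := andP (cb l).
by apply/andP; split; apply: ler_wpM2r => //; exact: ler_wpM2r.
Qed.

End symbol.

(** * Mass near the origin and decay of heat integrals *)

Section exponential_bounds.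
Context {R : realType}.

(** From [ln z <= z] at [z = y / (2 beta)], multiplied by [beta]. *)
Lemma powR_le_expR (beta : R) : 0 < beta -> exists2 A : R, 0 < A &
  forall y, 0 < y -> y `^ beta <= A * expR (y / 2).
Proof.
move=> b0; pose d := (2 * beta)^-1; have d0 : 0 < d by rewrite invr_gt0 mulr_gt0.
exists (expR (- (beta * ln d))); first exact: expR_gt0.
move=> y y0; rewrite /powR gt_eqF// -expRD ler_expR.
have := ln_sublinear (mulr_gt0 d0 y0); rewrite lnM ?posrE// => /ltW h.
have bd : beta * (d * y) = y / 2 by rewrite /d; field; rewrite gt_eqF.
have := ler_wpM2l (ltW b0) h; rewrite bd; lra.
Qed.

(** [powR_le_expR] bounds the general term by a geometric one, of ratio
    [exp(- 1 / 2)]. *)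
Lemma shell_series (beta : R) : 0 < beta -> exists2 S : R, 0 < S &
  forall N : nat, \sum_(j < N) expR (- j%:R) * j.+1%:R `^ beta <= S.
Proof.
move=> b0; have [A A0 hA] := powR_le_expR b0.
pose q : R := expR (- 2^-1).
have q0 : 0 < q by exact: expR_gt0.
have q1 : q < 1 by rewrite -expR0 ltr_expR oppr_lt0 invr_gt0.
have q1' : 0 < 1 - q by rewrite subr_gt0.
exists (A * expR (2^-1) / (1 - q)); first by rewrite divr_gt0// mulr_gt0// expR_gt0.
move=> N; apply: (@le_trans _ _ (\sum_(j < N) (A * expR 2^-1) * q ^+ j)).
  apply: ler_sum => j _.
  have := hA j.+1%:R (ltr0Sn _ _) => /(ler_wpM2l (expR_ge0 (- j%:R))) /le_trans; apply.
  rewrite mulrCA -expRD -mulrA -expRM_natl -expRD ler_pM2l// ler_expR -natr1.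
  by rewrite le_eqVlt; apply/orP; left; apply/eqP; field.
rewrite -mulr_sumr ler_pM2l ?mulr_gt0 ?expR_gt0//.
have := geometric_seriesE 1 (negbT (lt_eqF q1)) => /funeqP/(_ N).
rewrite /series/= big_mkord /geometric/=.
under eq_bigr do rewrite mul1r.
move=> ->; rewrite mul1r ler_pdivrMr// mulVf ?gt_eqF//.
by rewrite gerBl exprn_ge0// ltW.
Qed.

End exponential_bounds.

(** Only the distribution of the mass of [f] over the values of the radius [r]
    matters, so the space is left abstract. The exponent of the mass bounds is
    written [a * beta] because the heat integral rescales the radius by
    [t^(- 1 / a)], which turns it into decay of order [beta]. *)
Section heat_decay.
Context d (T : measurableType d) {R : realType} (mu : {measure set T -> \bar R}).
Variables (r f : T -> R) (a beta : R).
Hypotheses (mr : measurable_fun setT r) (mf : measurable_fun setT f).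
Hypotheses (r0 : forall x, 0 <= r x) (f0 : forall x, 0 <= f x).
Hypotheses (a0 : 0 < a) (beta0 : 0 < beta).

Definition mass (rho : R) : \bar R := (\int[mu]_(x in [set x | (r x < rho)%R]) (f x)%:E)%E.
Definition heat (k t : R) : \bar R := (\int[mu]_x (expR (- (k * t * r x `^ a)) * f x)%:E)%E.

Let mball (rho : R) : measurable [set x | r x < rho].
Proof.
rewrite (_ : [set _ | _] = setT `&` r @^-1` `]-oo, rho[%classic); first exact: mr.
by rewrite setTI; apply/seteqP; split => x /=; rewrite in_itv.
Qed.

Let mass_scale (c rho : R) : 0 <= c ->
  (c%:E * mass rho = \int[mu]_(x in [set x | (r x < rho)%R]) (c%:E * (f x)%:E))%E.
Proof.
move=> c0; apply/esym/(@ge0_integralZl _ _ _ mu _ (mball rho) (EFin \o f)).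
- by apply: measurable_funTS; exact/measurable_EFinP.
- by move=> x _; rewrite lee_fin.
- by rewrite lee_fin.
Qed.

Let mheat (k t : R) : measurable_fun setT (fun x => (expR (- (k * t * r x `^ a)) * f x)%:E).
Proof.
apply/measurable_EFinP; apply: measurable_funM => //.
apply: (measurableT_comp (@measurable_expR R)).
apply: (measurableT_comp (@oppr_measurable R setT)).
by apply: measurable_funM => //; exact: (measurableT_comp (@measurable_powR R a) mr).
Qed.

(** The ball of radius [rho = d0 (1 + t)^(- 1 / a)], with [d0 < rho0], already
    carries enough mass: there [k t r^a <= k d0^a], so the exponential is bounded
    below independently of [t]. *)
Lemma heat_lower (k L rho0 : R) : 0 <= k -> 0 < L -> 0 < rho0 ->
  (forall rho, 0 < rho < rho0 -> ((L * rho `^ (a * beta))%:E <= mass rho)%E) ->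
  exists2 C : R, 0 < C &
    forall t, 0 <= t -> ((C * (1 + t) `^ (- beta))%:E <= heat k t)%E.
Proof.
move=> k0 L0 rho00 massL.
pose d0 := rho0 / 2; have d00 : 0 < d0 by rewrite divr_gt0.
exists (expR (- (k * d0 `^ a)) * (L * d0 `^ (a * beta))).
  by rewrite !mulr_gt0 ?expR_gt0 ?powR_gt0.
move=> t t0; have t1 : 0 < 1 + t by rewrite ltr_pwDl.
pose rho := d0 * (1 + t) `^ (- a^-1).
have tle1 : (1 + t) `^ (- a^-1) <= 1.
  rewrite powRN invf_le1 ?powR_gt0// -[leLHS](powRr0 (1 + t)) ler_powR ?invr_ge0 ?(ltW a0)//.
  by rewrite lerDl.
have rho_gt0 : 0 < rho by rewrite mulr_gt0 ?powR_gt0.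
have rho_lt : rho < rho0.
  apply: (@le_lt_trans _ _ d0); first by rewrite ler_piMr// ltW.
  by rewrite /d0; lra.
have rhoE : rho `^ a = d0 `^ a * (1 + t)^-1.
  rewrite /rho powRM ?powR_ge0 ?(ltW d00)// -powRrM mulNr mulVf ?gt_eqF//.
  by rewrite powR_inv1// ltW.
apply: (@le_trans _ _ ((expR (- (k * d0 `^ a)))%:E * mass rho)%E).
  rewrite -mulrA EFinM lee_wpmul2l ?lee_fin ?expR_ge0//.
  apply: le_trans (massL rho _); last by rewrite rho_gt0.
  rewrite lee_fin (powRrM rho) rhoE powRM ?powR_ge0 ?invr_ge0 ?(ltW t1)// -powRrM mulrA.
  by rewrite -[(1 + t)^-1]powR_inv1 ?(ltW t1)// -powRrM mulN1r.
rewrite mass_scale; last exact: expR_ge0.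
apply: (@le_trans _ _ (\int[mu]_(x in [set x | (r x < rho)%R]) (expR (- (k * t * r x `^ a)) * f x)%:E)%E).
  apply: ge0_le_integral.
  - exact: mball.
  - by move=> x _; rewrite mule_ge0 ?lee_fin ?expR_ge0.
  - by apply: measurable_funTS; apply: measurable_funeM; exact/measurable_EFinP.
  - exact: (measurable_funTS (mheat k t)).
  move=> x /= xrho; rewrite -EFinM lee_fin; apply: ler_wpM2r => //; rewrite ler_expR lerN2 -mulrA ler_wpM2l//.
  have : r x `^ a <= d0 `^ a * (1 + t)^-1.
    by rewrite -rhoE ge0_ler_powR ?nnegrE ?(ltW a0) ?(ltW rho_gt0) ?(ltW xrho).
  move=> /(ler_wpM2l t0) /le_trans; apply.
  rewrite mulrCA ler_piMr ?powR_ge0// ler_pdivrMr// mul1r; lra.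
apply: ge0_subset_integral; [exact: mball|exact: measurableT|exact: mheat| |exact: subsetT].
by move=> x _; rewrite lee_fin mulr_ge0 ?expR_ge0.
Qed.

(* The term whose index is the integer part of [x] alone dominates. The
   exponential is thus below a sum of multiples of indicators of balls. *)
Let expR_le_shells (x : R) : 0 <= x ->
  ((expR (- x))%:E <= \sum_(j <oo) (expR (- j%:R) * (x < j.+1%:R)%R%:R)%:E)%E.
Proof.
move=> x0; pose j := Num.truncn x.
have jx : j%:R <= x < j.+1%:R by apply: truncn_itv.
have ge0 i : (0%N <= i)%N -> true -> (0 <= (expR (- i%:R) * (x < i.+1%:R)%R%:R)%:E :> \bar R)%E.
  by move=> _ _; rewrite lee_fin mulr_ge0 ?expR_ge0.
apply: le_trans (nneseries_lim_ge j.+1 ge0).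
rewrite big_nat_recr//= -[leLHS]add0e leeD//.
  by apply: sume_ge0 => i _; apply: ge0.
by case/andP: jx => jx ->; rewrite mulr1 lee_fin ler_expR lerN2.
Qed.

Let fx0 x : (0 <= (f x)%:E)%E. Proof. by rewrite lee_fin. Qed.

Let shell (k t : R) (j : nat) (x : T) : \bar R :=
  (expR (- j%:R) * (k * t * r x `^ a < j.+1%:R)%R%:R * f x)%:E.

Let mra : measurable_fun setT (fun x => r x `^ a).
Proof. exact: (measurableT_comp (@measurable_powR R a) mr). Qed.

Let mshell k t j : measurable_fun setT (shell k t j).
Proof.
apply/measurable_EFinP; apply: measurable_funM => //; apply: measurable_funM => //.
rewrite (_ : (fun _ => _) = \1_[set x | k * t * r x `^ a < j.+1%:R]).
  apply: measurable_indic.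
  rewrite (_ : [set _ | _] = setT `&` (fun x => k * t * r x `^ a) @^-1` `]-oo, j.+1%:R[%classic).
    by apply: (measurable_funM _ mra).
  by rewrite setTI; apply/seteqP; split => x /=; rewrite in_itv.
by apply/funext => x; rewrite indicE; congr (nat_of_bool _)%:R; apply/idP/idP; rewrite inE.
Qed.

Let shell_ge0 k t j x : (0 <= shell k t j x)%E.
Proof. by rewrite lee_fin !mulr_ge0 ?expR_ge0. Qed.

(** The ball [k t r^a < j + 1] has radius [((j + 1) / (k t))^(1 / a)], hence mass at
    most [K ((j + 1) / (k t))^beta]; the weights [exp(- j)] make the sum over [j]
    converge. *)
Lemma heat_upper (k K : R) : 0 < k -> 0 <= K ->
  (forall rho, 0 < rho -> (mass rho <= (K * rho `^ (a * beta))%:E)%E) ->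
  exists2 C : R, 0 < C & forall t, 0 < t -> (heat k t <= (C * t `^ (- beta))%:E)%E.
Proof.
move=> k0 K0 massK; have [S S0 hS] := shell_series beta0.
exists ((K + 1) * k `^ (- beta) * S); first by rewrite !mulr_gt0 ?powR_gt0// ltr_wpDl.
move=> t t0; have kt0 : 0 < k * t by rewrite mulr_gt0.
apply: (@le_trans _ _ (\int[mu]_x (\sum_(j <oo) shell k t j x))%E).
  apply: ge0_le_integral.
  - exact: measurableT.
  - by move=> x _; rewrite lee_fin mulr_ge0 ?expR_ge0.
  - exact: mheat.
  - by apply: ge0_emeasurable_sum => // j x _ _; exact: shell_ge0.
  move=> x _; rewrite EFinM.
  apply: (@le_trans _ _ ((\sum_(j <oo) (expR (- j%:R) * (k * t * r x `^ a < j.+1%:R)%R%:R)%:E) * (f x)%:E)%E).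
    by apply: lee_wpmul2r; [exact: fx0|apply: expR_le_shells; rewrite mulr_ge0 ?powR_ge0// ltW].
  rewrite muleC -nneseriesZl; last by move=> j _; rewrite lee_fin mulr_ge0 ?expR_ge0.
  by apply: lee_nneseries => j _ *; rewrite -EFinM ?lee_fin ?mulr_ge0 ?expR_ge0// mulrC.
rewrite integral_nneseries; last 3 first.
- exact: measurableT.
- by move=> j; exact: mshell.
- by move=> j x _; exact: shell_ge0.
have bound j : (\int[mu]_x shell k t j x <=
    (K * (k * t) `^ (- beta) * (expR (- j%:R) * j.+1%:R `^ beta))%:E)%E.
  pose rho := (j.+1%:R / (k * t)) `^ a^-1.
  have q0 : 0 < j.+1%:R / (k * t) by rewrite divr_gt0.
  have rho0 : 0 < rho by exact: powR_gt0.
  have -> : (\int[mu]_x shell k t j x = (expR (- j%:R))%:E * mass rho)%E.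
    rewrite mass_scale; last exact: expR_ge0.
    rewrite [RHS]integral_mkcond; apply: eq_integral => x _.
    rewrite patchE /shell.
    have -> : (x \in [set x | r x < rho]) = (r x < rho) by apply/idP/idP; rewrite inE.
    have -> : (k * t * r x `^ a < j.+1%:R) = (r x < rho).
      have rhoa : rho `^ a = j.+1%:R / (k * t).
        by rewrite /rho -powRrM mulVf ?gt_eqF// powRr1// ltW.
      rewrite mulrC -ltr_pdivlMr// -rhoa; apply/idP/idP => [|h].
        by rewrite !ltNge; apply: contra => h; rewrite ge0_ler_powR ?nnegrE ?(ltW a0) ?(ltW rho0).
      by rewrite gt0_ltr_powR ?nnegrE// ltW.
    by case: (r x < rho); rewrite ?mulr1 ?mulr0 ?mul0r ?EFinM.
  apply: (@le_trans _ _ ((expR (- j%:R))%:E * (K * rho `^ (a * beta))%:E)%E).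
    by apply: lee_wpmul2l; [rewrite lee_fin expR_ge0|exact: massK].
  rewrite -EFinM lee_fin /rho -powRrM mulrA mulVf ?gt_eqF// mul1r.
  have -> : (j.+1%:R / (k * t)) `^ beta = j.+1%:R `^ beta * (k * t) `^ (- beta).
    have kt1 : 0 <= (k * t)^-1 by rewrite invr_ge0 ltW.
    rewrite (powRM _ (ler0n R j.+1) kt1); congr (_ * _).
    by rewrite -mulN1r powRrM powR_inv1// ltW.
  by rewrite le_eqVlt; apply/orP; left; apply/eqP; ring.
apply: lime_le.
  by apply: is_cvg_nneseries => j _ _; apply: integral_ge0 => x _; exact: shell_ge0.
apply: nearW => N; rewrite big_mkord.
apply: (@le_trans _ _ (\sum_(j < N) (K * (k * t) `^ (- beta) * (expR (- j%:R) * j.+1%:R `^ beta))%:E)%E).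
  by apply: lee_sum => j _; exact: bound.
rewrite sumEFin lee_fin -mulr_sumr.
apply: (@le_trans _ _ (K * (k * t) `^ (- beta) * S)).
  by rewrite ler_wpM2l// mulr_ge0// powR_ge0.
rewrite (powRM _ (ltW k0) (ltW t0)).
have -> : (K + 1) * k `^ (- beta) * S * t `^ (- beta) =
    (K + 1) * (k `^ (- beta) * t `^ (- beta) * S) by ring.
by rewrite -mulrA ler_wpM2r ?lerDl// !mulr_ge0 ?powR_ge0// ltW.
Qed.

Lemma heat_le_mass (k t : R) : 0 <= k -> 0 <= t -> (heat k t <= \int[mu]_x (f x)%:E)%E.
Proof.
move=> k0 t0; apply: ge0_le_integral.
- exact: measurableT.
- by move=> x _; rewrite lee_fin mulr_ge0 ?expR_ge0.
- exact: mheat.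
- exact/measurable_EFinP.
move=> x _; rewrite lee_fin; apply: ler_piMl; first exact: f0.
rewrite -[leRHS]expR0 ler_expR oppr_le0.
by apply: mulr_ge0; [exact: mulr_ge0|exact: powR_ge0].
Qed.

Let mass_le (rho : R) : (mass rho <= \int[mu]_x (f x)%:E)%E.
Proof.
apply: ge0_subset_integral; [exact: mball|exact: measurableT|exact/measurable_EFinP| |exact: subsetT].
by move=> x _; exact: fx0.
Qed.

(** For [rho >= rho0] the total mass is itself at most a multiple of
    [rho^(a beta)], so a bound for small balls extends to all of them. For
    [t <= 1] the total mass bounds the integral, and for [t >= 1] the powers of
    [t] and of [1 + t] are comparable up to [2^beta]. *)
Lemma heat_upper_finite (k K rho0 : R) : 0 < k -> 0 <= K -> 0 < rho0 ->
  (\int[mu]_x (f x)%:E < +oo)%E ->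
  (forall rho, 0 < rho < rho0 -> (mass rho <= (K * rho `^ (a * beta))%:E)%E) ->
  exists2 C : R, 0 < C &
    forall t, 0 <= t -> (heat k t <= (C * (1 + t) `^ (- beta))%:E)%E.
Proof.
move=> k0 K0 rho00 finf massK.
have E0 : (0 <= \int[mu]_x (f x)%:E)%E by apply: integral_ge0 => x _; exact: fx0.
have [E EE] : exists E : R, (\int[mu]_x (f x)%:E)%E = E%:E.
  by exists (fine (\int[mu]_x (f x)%:E)%E); rewrite fineK// ge0_fin_numE.
have {E0} E0 : 0 <= E by rewrite -lee_fin -EE.
have ab0 : 0 <= a * beta by rewrite mulr_ge0 ?ltW.
have p0 : 0 < rho0 `^ (a * beta) by exact: powR_gt0.
have [||C C0 hC] := @heat_upper k (K + E / rho0 `^ (a * beta)) k0.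
- by rewrite addr_ge0// divr_ge0// ltW.
- move=> rho rho_gt0; have [rlt|rge] := ltP rho rho0.
    apply: le_trans (massK rho _) _; first by rewrite rho_gt0.
    by rewrite lee_fin ler_wpM2r ?powR_ge0// lerDl divr_ge0// ltW.
  apply: le_trans (mass_le rho) _; rewrite EE lee_fin.
  apply: (@le_trans _ _ (E / rho0 `^ (a * beta) * rho `^ (a * beta))).
    rewrite -mulrA ler_peMr// ler_pdivlMl// mulr1.
    by rewrite ge0_ler_powR ?nnegrE// ltW.
  by rewrite ler_wpM2r ?powR_ge0// lerDr.
have two0 : 0 < 2 `^ beta :> R by exact: powR_gt0.
exists ((C + E) * 2 `^ beta); first by rewrite mulr_gt0// ltr_wpDr.
move=> t t0; have t1 : 0 < 1 + t by rewrite ltr_pwDl.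
have half1 : ((1 + t) / 2) `^ (- beta) = 2 `^ beta * (1 + t) `^ (- beta).
  have h2 : 0 <= 2^-1 :> R by rewrite invr_ge0.
  rewrite (powRM _ (ltW t1) h2) mulrC; congr (_ * _).
  by rewrite -[2^-1]powR_inv1// -powRrM mulN1r opprK.
have decr (x y : R) : 0 < x -> x <= y -> y `^ (- beta) <= x `^ (- beta).
  move=> x0 xy; have y0 : 0 < y by exact: lt_le_trans xy.
  by rewrite !powRN lef_pV2 ?posrE ?powR_gt0// ge0_ler_powR ?nnegrE// ltW.
rewrite -mulrA -half1; have h0 : 0 < (1 + t) / 2 by rewrite divr_gt0.
have [tle|tgt] := leP t 1.
  apply: le_trans (heat_le_mass (ltW k0) t0) _; rewrite EE lee_fin.
  have h1 : 1 <= ((1 + t) / 2) `^ (- beta).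
    apply: (@le_trans _ _ (1 `^ (- beta))); first by rewrite powR1.
    by apply: decr => //; rewrite ler_pdivrMr// mul1r -[leRHS]/(1 + 1) lerD2l.
  apply: (@le_trans _ _ (C + E)); first by rewrite lerDr ltW.
  by rewrite ler_peMr// addr_ge0// ltW.
apply: le_trans (hC t _) _; first exact: lt_trans tgt.
rewrite lee_fin; apply: ler_pM; [exact: ltW|exact: powR_ge0|by rewrite lerDl|].
apply: decr => //; rewrite ler_pdivrMr// mulr_natr mulr2n lerD2r; exact: ltW.
Qed.

End heat_decay.

(** * Decay of the solution *)

Section power_mass.
Context {R : realType}.
Implicit Types (G : R -> \bar R) (s L K : R) (l : \bar R).

Lemma cvg_power_lower G s l L :
  ((rho `^ (- s))%:E * G rho)%E @[rho --> 0^'+] --> l -> (L%:E < l)%E ->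
  exists2 rho0 : R, 0 < rho0 &
    forall rho, 0 < rho < rho0 -> ((L * rho `^ s)%:E <= G rho)%E.
Proof.
move=> cG Ll; have nl : nbhs l [set y | (L%:E < y)%E].
  by apply: open_nbhs_nbhs; split => //; exact: open_ereal_gt_ereal.
have : \forall rho \near (0 : R)^'+, (L%:E < (rho `^ (- s))%:E * G rho)%E by exact: cG nl.
rewrite near_withinE => /nbhs_ballP[e /= e0 he]; exists e => // rho /andP[rho0 rhoe].
have := he rho; rewrite /ball/= sub0r normrN gtr0_norm// => /(_ rhoe rho0) /ltW h.
have p0 : 0 < rho `^ s by exact: powR_gt0.
rewrite mulrC EFinM -lee_pdivlMl//.
by rewrite powRN in h.
Qed.

Lemma cvg_power_upper G s l K :
  ((rho `^ (- s))%:E * G rho)%E @[rho --> 0^'+] --> l -> (l < K%:E)%E ->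
  exists2 rho0 : R, 0 < rho0 &
    forall rho, 0 < rho < rho0 -> (G rho <= (K * rho `^ s)%:E)%E.
Proof.
move=> cG lK; have nl : nbhs l [set y | (y < K%:E)%E].
  by apply: open_nbhs_nbhs; split => //; exact: open_ereal_lt_ereal.
have : \forall rho \near (0 : R)^'+, ((rho `^ (- s))%:E * G rho < K%:E)%E by exact: cG nl.
rewrite near_withinE => /nbhs_ballP[e /= e0 he]; exists e => // rho /andP[rho0 rhoe].
have := he rho; rewrite /ball/= sub0r normrN gtr0_norm// => /(_ rhoe rho0) /ltW h.
have p0 : 0 < rho `^ s by exact: powR_gt0.
rewrite mulrC EFinM -lee_pdivrMl//.
by rewrite powRN in h.
Qed.

End power_mass.

Section solution_bounds.
Context {R : realType} (n : nat).
Local Notation mu := (lebesgue_tuple R n).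
Variables (alpha c0 c1 : R) (c : 'I_n -> R).
Hypothesis cb : forall i, c0 <= c i <= c1.
Variables (M P : Rn R n -> 'M[R]_n).
Hypothesis symbolM : {ae mu, forall xi,
     (P xi)^T *m P xi = 1%:M /\
     M xi = invmx (P xi) *m frac_diag alpha c xi *m P xi}.
Variables (v0 : vfield R n) (v : R -> vfield R n).
Hypothesis v_sol : solution M v0 v.
Variable uhat : vfield R n.
Hypothesis v0_uhat : is_fourier v0 uhat.

Local Notation f := (fun xi => cnorm (uhat xi) ^+ 2).

(** The solution at time [t] comes with its own transform of the data, which agrees
    almost everywhere with [uhat]; the pointwise bounds on the symbol then
    integrate. *)
Lemma solution_heat t : 0 <= t ->
  (heat mu enorm f (2 * alpha) (2 * c1) t <= ((2 * pi) ^+ n)%:E * energy (v t))%E /\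
  (((2 * pi) ^+ n)%:E * energy (v t) <= heat mu enorm f (2 * alpha) (2 * c0) t)%E.
Proof.
move=> t0; have [uhat_t [what [Fu Fw what_ae]]] := v_sol t0.
have uu := fourier_unique v0_uhat Fu.
have mf2 : measurable_fun setT f.
  by case: v0_uhat => _ [mf _] _; exact: measurable_cnorm_sqr.
have mw2 : measurable_fun setT (fun xi => cnorm (what xi) ^+ 2).
  by case: Fw => _ [mw _] _; exact: measurable_cnorm_sqr.
have mh k : measurable_fun setT
    (fun xi : Rn R n => (expR (- (k * t * enorm xi `^ (2 * alpha))) * f xi)%:E).
  apply/measurable_EFinP; apply: measurable_funM => //.
  apply: (measurableT_comp (@measurable_expR R)).
  apply: (measurableT_comp (@oppr_measurable R setT)).
  apply: measurable_funM => //.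
  exact: (measurableT_comp (@measurable_powR R (2 * alpha)) (@measurable_enorm R n)).
have h0 k xi : (0 <= (expR (- (k * t * enorm xi `^ (2 * alpha))) * f xi)%:E)%E.
  by rewrite lee_fin mulr_ge0 ?expR_ge0 ?sqr_ge0.
have bounds : {ae mu, forall xi,
    expR (- (2 * c1 * t * enorm xi `^ (2 * alpha))) * f xi <= cnorm (what xi) ^+ 2 /\
    cnorm (what xi) ^+ 2 <= expR (- (2 * c0 * t * enorm xi `^ (2 * alpha))) * f xi}.
  apply: filterS3 uu what_ae symbolM => xi uE wE [PP MP]; rewrite uE wE.
  by have /andP[] := cnorm_mexp_symbol cb (uhat_t xi) t0 PP MP.
rewrite -(fourier_energy Fw); split; apply: ae_ge0_le_integral.
- exact: measurableT.
- by move=> xi _; exact: h0.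
- exact: mh.
- by move=> xi _; rewrite lee_fin sqr_ge0.
- exact/measurable_EFinP.
- by apply: filterS bounds => xi [h _] *; rewrite lee_fin.
- exact: measurableT.
- by move=> xi _; rewrite lee_fin sqr_ge0.
- exact/measurable_EFinP.
- by move=> xi _; exact: h0.
- exact: mh.
- by apply: filterS bounds => xi [_ h] *; rewrite lee_fin.
Qed.

End solution_bounds.

Section solution_decay.
Context {R : realType} (n : nat).
Local Notation mu := (lebesgue_tuple R n).
Variables (alpha c0 c1 : R) (c : 'I_n -> R).
Hypotheses (alpha0 : 0 < alpha) (c0_gt0 : 0 < c0).
Hypothesis cb : forall i, c0 <= c i <= c1.
Variables (M P : Rn R n -> 'M[R]_n).
Hypothesis symbolM : {ae mu, forall xi,
     (P xi)^T *m P xi = 1%:M /\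
     M xi = invmx (P xi) *m frac_diag alpha c xi *m P xi}.
Variables (v0 : vfield R n) (v : R -> vfield R n).
Hypothesis v_sol : solution M v0 v.

Let alpha2 : 0 < 2 * alpha. Proof. by rewrite mulr_gt0. Qed.

Let Z0 : 0 < (2 * pi : R) ^+ n. Proof. by rewrite exprn_gt0// mulr_gt0// pi_gt0. Qed.

(* The order of the indicator is parametrized by the decay rate [beta] that it
   produces. *)
Let exponentE (beta : R) : - 2 * (alpha * beta - n%:R / 2) - n%:R = - (2 * alpha * beta).
Proof. by field. Qed.

(** A positive indicator, even infinite, bounds the mass of small balls from
    below. *)
Lemma solution_decay_lower (beta : R) (l : \bar R) : 0 < beta -> 0 <= c1 ->
  decay_indicator v0 (alpha * beta - n%:R / 2) l -> (0 < l)%E ->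
  exists2 C : R, 0 < C &
    forall t, 0 <= t -> ((C * (1 + t) `^ (- beta))%:E <= L2norm (v t) ^+ 2)%E.
Proof.
move=> beta0 c1_ge0 [uhat Fu cl] l0; rewrite exponentE in cl.
have [L L0 Ll] : exists2 L : R, 0 < L & (L%:E < l)%E.
  case: l l0 {cl} => [l||]; rewrite ?lte_fin.
  - by move=> l0; exists (l / 2); rewrite ?divr_gt0// lte_fin ltr_pdivrMr// ltr_pMr// ltr1n.
  - by move=> _; exists 1 => //; rewrite ltry.
  - by rewrite ltNge leNye.
have [rho0 rho00 massL] := cvg_power_lower cl Ll.
have mf : measurable_fun setT (fun xi => cnorm (uhat xi) ^+ 2).
  by case: Fu => _ [m _] _; exact: measurable_cnorm_sqr.
have f0 xi : 0 <= cnorm (uhat xi) ^+ 2 by exact: sqr_ge0.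
have k0 : 0 <= 2 * c1 by rewrite mulr_ge0.
have [C C0 hC] := heat_lower (@measurable_enorm R n) mf (@enorm_ge0 R n) f0
  alpha2 k0 L0 rho00 massL.
exists (((2 * pi) ^+ n)^-1 * C); first by rewrite mulr_gt0// invr_gt0.
move=> t t0; rewrite L2norm_sqr -mulrA EFinM lee_pdivrMl//.
have [h _] := solution_heat cb symbolM v_sol Fu t0.
by apply: le_trans h; exact: hC.
Qed.

(** A finite indicator, even zero, bounds the mass of small balls from above. *)
Lemma solution_decay_upper (beta : R) (l : \bar R) : 0 < beta ->
  decay_indicator v0 (alpha * beta - n%:R / 2) l -> (l < +oo)%E ->
  exists2 C : R, 0 < C &
    forall t, 0 <= t -> (L2norm (v t) ^+ 2 <= (C * (1 + t) `^ (- beta))%:E)%E.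
Proof.
move=> beta0 [uhat Fu cl] l0; rewrite exponentE in cl.
have [K K0 lK] : exists2 K : R, 0 <= K & (l < K%:E)%E.
  case: l l0 {cl} => [l||]//; first by exists (`|l| + 1) => //; rewrite lte_fin ltr_pwDr// ler_norm.
  by move=> _; exists 0 => //; rewrite ltNyr.
have [rho0 rho00 massK] := cvg_power_upper cl lK.
have mf : measurable_fun setT (fun xi => cnorm (uhat xi) ^+ 2).
  by case: Fu => _ [m _] _; exact: measurable_cnorm_sqr.
have f0 xi : 0 <= cnorm (uhat xi) ^+ 2 by exact: sqr_ge0.
have k0 : 0 < 2 * c0 by rewrite mulr_gt0.
have finf : (\int[mu]_xi (cnorm (uhat xi) ^+ 2)%:E < +oo)%E.
  by case: Fu => _ [m]; rewrite L2norm_lty.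
have [C C0 hC] := heat_upper_finite (@measurable_enorm R n) mf (@enorm_ge0 R n) f0
  alpha2 beta0 k0 K0 rho00 finf massK.
exists (((2 * pi) ^+ n)^-1 * C); first by rewrite mulr_gt0// invr_gt0.
move=> t t0; rewrite L2norm_sqr -mulrA EFinM lee_pdivlMl//.
have [_ h] := solution_heat cb symbolM v_sol Fu t0.
by apply: le_trans h _; exact: hC.
Qed.

End solution_decay.

Theorem theorem2p10 (R : realType) (n : nat) (n_gt0 : (0 < n)%N)
  (alpha : R) (alpha_gt0 : 0 < alpha) (alpha_le1 : alpha <= 1)
  (c0 : R) (c0_gt0 : 0 < c0) (c : 'I_n -> R) (c_gt : forall i, c0 < c i)
  (M P : Rn R n -> 'M[R]_n)
  (symbolM : {ae lebesgue_tuple R n, forall xi,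
     (P xi)^T *m P xi = 1%:M /\
     M xi = invmx (P xi) *m frac_diag alpha c xi *m P xi})
  (v0 : vfield R n) (v0L2 : in_L2 v0)
  (rstar : \bar R) (v0_decay : decay_character v0 rstar)
  (v : R -> vfield R n) (v_sol : solution M v0 v) :
  [/\ forall r : R, rstar = r%:E -> - n%:R / 2 < r ->
        exists C1 C2 : R, [/\ 0 < C1, 0 < C2 &
          forall t : R, 0 <= t ->
            ((C1 * (1 + t) `^ (- alpha^-1 * (n%:R / 2 + r)))%:E
               <= L2norm (v t) ^+ 2)%E /\
            (L2norm (v t) ^+ 2
               <= (C2 * (1 + t) `^ (- alpha^-1 * (n%:R / 2 + r)))%:E)%E],
      rstar = (- n%:R / 2)%:E ->
        forall eps : R, 0 < eps -> exists2 C : R, 0 < C &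
          forall t : R, 0 <= t ->
            ((C * (1 + t) `^ (- eps))%:E <= L2norm (v t) ^+ 2)%E
    & rstar = +oo%E ->
        forall m : R, 0 < m -> exists2 C : R, 0 < C &
          forall t : R, 0 <= t ->
            (L2norm (v t) ^+ 2 <= (C * (1 + t) `^ (- m))%:E)%E ].
Proof.
(* The sum is a common upper bound because the coefficients are positive. *)
pose c1 := \sum_i c i.
have c_ge0 i : 0 <= c i by exact: ltW (lt_trans c0_gt0 (c_gt i)).
have c1_ge0 : 0 <= c1 by exact: sumr_ge0.
have cb i : c0 <= c i <= c1.
  by rewrite ltW//= /c1 (bigD1 i)//= lerDl sumr_ge0.
have gt_min (b : R) : 0 < b -> - n%:R / 2 < alpha * b - n%:R / 2.
  by move=> b0; rewrite mulNr ltrDr mulr_gt0.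
split.
- move=> r rE rmin.
  have [_ [l Pl /andP[l0 loo]]] : finite_indicator v0 r.
    case: v0_decay rE => [s [s_ind _] [<-]//|_ _ [rE]|//].
    by move: rmin; rewrite -rE ltxx.
  have b0 : 0 < alpha^-1 * (n%:R / 2 + r).
    by rewrite mulr_gt0 ?invr_gt0// addrC -[n%:R / 2]opprK subr_gt0 -mulNr.
  have rE' : r = alpha * (alpha^-1 * (n%:R / 2 + r)) - n%:R / 2.
    by rewrite mulrA divff ?gt_eqF// mul1r addrC addKr.
  rewrite mulNr; rewrite rE' in Pl.
  have [C1 C10 h1] := solution_decay_lower alpha_gt0 cb symbolM v_sol b0 c1_ge0 Pl l0.
  have [C2 C20 h2] := solution_decay_upper alpha_gt0 c0_gt0 cb symbolM v_sol b0 Pl loo.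
  by exists C1, C2; split=> // t t0; split; [exact: h1|exact: h2].
- move=> rE eps eps0.
  have Poo : decay_indicator v0 (alpha * eps - n%:R / 2) +oo%E.
    case: v0_decay rE => [s [[smin _] _] [sE]|_ Poo _|//]; last exact/Poo/gt_min.
    by move: smin; rewrite sE ltxx.
  exact: (solution_decay_lower alpha_gt0 cb symbolM v_sol eps0 c1_ge0 Poo).
move=> rE m m0.
have P0 : decay_indicator v0 (alpha * m - n%:R / 2) 0%E.
  by case: v0_decay rE => // _ P0 _; exact/P0/gt_min.
exact: (solution_decay_upper alpha_gt0 c0_gt0 cb symbolM v_sol m0 P0).
Qed.
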